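(* Let $s=k+1+\rho$, where $k\geq1$ is an integer and $\rho\in(0,1]$. There exists a constant $D_s\geq1$ depending only on $s$ with the following property. Suppose that $\Theta\subset E$ is an open subset of a Banach space $E$, that $f\in C^s(\Theta)$, that $H$ is a random homotopy between $\theta$ and $\hat\theta$ which is a.s. $k+1$ times continuously differentiable in $\Theta\times[0,1]$, and that $$ \mathbb E\Bigl(\|H\|^{-}_{C^{s-1,0}(\Theta\times[0,1])}\vee1\Bigr)^{s-1}\|\dot H\|_{C^{s-1,0}(\Theta\times[0,1])}<\infty . $$ Then, for all $1\leq j\leq k$, $$ \|\mathcal B^jf\|_{C^{1+\rho}(\Theta)}\leq D_s\|f\|_{C^s(\Theta)}\left(\mathbb E\Bigl(\|H\|^{-}_{C^{s-1,0}(\Theta\times[0,1])}\vee1\Bigr)^{s-1}\|\dot H\|_{C^{s-1,0}(\Theta\times[0,1])}\right)^j . $$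
   Context: Setting. $\{P_\theta:\theta\in\Theta\}$ is a statistical model, $\hat\theta=\hat\theta(X)\in\Theta$ is an estimator of $\theta$ based on $X\sim P_\theta$, and its distribution $P(\theta;A)=\mathbb P_\theta\{\hat\theta\in A\}$ is a Markov kernel on $\Theta$. For bounded measurable $g:\Theta\to\mathbb R$, $(\mathcal Tg)(\theta)=\mathbb E_\theta g(\hat\theta)=\int_\Theta g(t)P(\theta;dt)$, and $\mathcal B=\mathcal T-\mathcal I$, $\mathcal I$ the identity. Random homotopy. A random homotopy between $\theta$ and $\hat\theta$ is an a.s. continuous stochastic process $H(\theta;t)$, $\theta\in\Theta$, $t\in[0,1]$, with values in $\Theta$, defined on some probability space, such that for all $\theta\in\Theta$: $H(\theta;0)=\theta$ and $H(\theta;1)\overset{d}{=}\hat\theta$, $\hat\theta\sim P(\theta;\cdot)$. $\dot H(\theta;t)=\frac{d}{dt}H(\theta;t)$. Norms. For Banach spaces $E,F$, open $U\subset E$ and $s=m+\alpha$ with integer $m\geq0$, $\alpha\in(0,1]$, and $f:U\to F$ that is $m$ times continuously Fréchet differentiable, $$\|f\|^{-}_{C^s(U)}=\max\Bigl(\max_{0\leq j\leq m-1}\sup_{x\neq x'}\frac{\|f^{(j)}(x)-f^{(j)}(x')\|}{\|x-x'\|},\ \sup_{x\neq x'}\frac{\|f^{(m)}(x)-f^{(m)}(x')\|}{\|x-x'\|^\alpha}\Bigr),$$ $\|f\|_{C^s(U)}=\max(\sup_{x\in U}\|f(x)\|,\|f\|^-_{C^s(U)})$ (operator norms of multilinear forms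 for derivatives); $C^s(U)$ is the space of such functions with finite norm (real-valued for $f$ above). For $V:\Theta\times[0,1]\to F$: $\|V\|_{C^{s,0}(\Theta\times[0,1])}=\sup_{t\in[0,1]}\|V(\cdot;t)\|_{C^s(\Theta)}$ and $\|V\|^-_{C^{s,0}(\Theta\times[0,1])}=\sup_{t\in[0,1]}\|V(\cdot;t)\|^-_{C^s(\Theta)}$. *)

(* Defs.v *)
From HB Require Import structures.
From mathcomp Require Import all_boot all_order all_algebra.
From mathcomp Require Import all_classical all_reals all_analysis.
From mathcomp Require Import measurable_realfun.

Set Implicit Arguments.
Unset Strict Implicit.
Unset Printing Implicit Defensive.
Import Order.TTheory GRing.Theory Num.Theory.
Import numFieldNormedType.Exports.
Local Open Scope classical_set_scope.
Local Open Scope ring_scope.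

Section clinear_type.
Context {R : realType} {E F : normedModType R}.

Definition clinear_pred : {pred E -> F} :=
  mem [set f : E -> F | linear f /\ continuous f].

Record clinear := CLinear {
  clinear_fun :> E -> F ;
  clinear_subproof : clinear_fun \in clinear_pred }.

HB.instance Definition _ := [isSub of clinear for clinear_fun].
HB.instance Definition _ := [Choice of clinear by <:].

Lemma clinear_submod_closed : submod_closed clinear_pred.
Proof.
split=> [|a f g]; rewrite !inE.
  by split=> [b x y|]; [rewrite /= scaler0 addr0 | exact: cst_continuous].
move=> [lf cf] [lg cg]; split=> [b x y|x] /=.
  rewrite !fctE lf lg !scalerDr !scalerA [a * b]mulrC -!addrA.
  by congr (_ + _); rewrite addrCA.
by apply: cvgD; [apply: cvgZr; exact: cf | exact: cg].
Qed.

HB.instance Definition _ := GRing.isSubmodClosed.Build R (E -> F) clinear_pred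
  clinear_submod_closed.
HB.instance Definition _ := [SubChoice_isSubLmodule of clinear by <:].

Lemma clinear_linear (L : clinear) : linear L.
Proof. by have := clinear_subproof L; rewrite inE => -[]. Qed.

Lemma clinear_continuous (L : clinear) : continuous L.
Proof. by have := clinear_subproof L; rewrite inE => -[]. Qed.

HB.instance Definition _ (L : clinear) :=
  GRing.isLinear.Build R E F *:%R (clinear_fun L) (clinear_linear L).

Lemma clinearD (L M : clinear) x : (L + M) x = L x + M x. Proof. by []. Qed.
Lemma clinearZ a (L : clinear) x : (a *: L) x = a *: L x. Proof. by []. Qed.
Lemma clinear0 x : (0 : clinear) x = 0. Proof. by []. Qed.

Definition opnorm (L : clinear) : R :=
  sup [set `|L x| | x in [set x : E | `|x| <= 1]].

Lemma opnorm_has_sup (L : clinear) :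
  has_sup [set `|L x| | x in [set x : E | `|x| <= 1]].
Proof.
split; first by exists `|L 0|; exists 0 => //=; rewrite normr0.
have /linear_boundedP : bounded_near L (nbhs (0 : E)).
  by apply: continuous_linear_bounded; exact: clinear_continuous.
move=> /pinfty_ex_gt0[r r0 Lr]; exists r => _ [x /= x1 <-].
by rewrite (le_trans (Lr x))// ler_piMr// ltW.
Qed.

Lemma opnorm_ge (L : clinear) x : `|x| <= 1 -> `|L x| <= opnorm L.
Proof. by move=> x1; apply: (sup_upper_bound (opnorm_has_sup L)); exists x. Qed.

Lemma opnorm_le (L : clinear) (M : R) :
  (forall x, `|x| <= 1 -> `|L x| <= M) -> opnorm L <= M.
Proof.
move=> LM; apply: ge_sup; first exact: (opnorm_has_sup L).1.
by move=> _ [x /= x1 <-]; exact: LM.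
Qed.

Lemma opnormP (L : clinear) x : `|L x| <= opnorm L * `|x|.
Proof.
have [->|x0] := eqVneq x 0; first by rewrite linear0 !normr0 mulr0.
have nx : 0 < `|x| by rewrite normr_gt0.
rewrite -ler_pdivrMr//.
have -> : `|L x| / `|x| = `|L (`|x|^-1 *: x)|.
  by rewrite linearZ/= normrZ ger0_norm ?invr_ge0// mulrC.
by apply: opnorm_ge; rewrite normrZ ger0_norm ?invr_ge0// mulVf ?gt_eqF.
Qed.

Lemma opnorm_triangle (L M : clinear) : opnorm (L + M) <= opnorm L + opnorm M.
Proof.
apply: opnorm_le => x x1; rewrite clinearD (le_trans (ler_normD _ _))//.
by rewrite lerD// opnorm_ge.
Qed.

Lemma opnorm_eq0 (L : clinear) : opnorm L = 0 -> L = 0.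
Proof.
move=> L0; apply/val_inj/funext => x; change (L x = 0).
apply/eqP; rewrite -normr_le0.
by have := opnormP L x; rewrite L0 mul0r.
Qed.

Lemma opnormZ a (L : clinear) : opnorm (a *: L) = `|a| * opnorm L.
Proof.
have le b (M : clinear) : opnorm (b *: M) <= `|b| * opnorm M.
  apply: opnorm_le => x x1; rewrite clinearZ normrZ.
  by rewrite ler_wpM2l// opnorm_ge.
apply/eqP; rewrite eq_le le /=.
have [->|a0] := eqVneq a 0.
  rewrite normr0 mul0r; apply: le_trans (opnorm_ge _ (_ : `|0| <= 1)) => //.
  by rewrite normr0.
rewrite mulrC -ler_pdivlMr ?normr_gt0// mulrC -normfV.
by rewrite (le_trans _ (le _ _))// scalerA mulVf// scale1r.
Qed.

HB.instance Definition _ := Lmodule_isNormed.Build R clinear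
  opnorm_triangle opnormZ opnorm_eq0.

End clinear_type.
Arguments clinear {R} E F.

Section smoothness.
Context {R : realType} {E : normedModType R}.
Implicit Types (U : set E) (m : nat) (alpha : R).

(* Fréchet derivative at x of f restricted to U: on an open set this is the
   usual one (see is_fderivE); at the points of [0, 1] or of U x [0, 1] it is
   one-sided in the bounded variable where necessary. *)
Definition is_fderiv U (F : normedModType R) (f : E -> F) (x : E)
    (L : clinear E F) : Prop :=
  forall e : R, 0 < e ->
    \forall y \near within U (nbhs x), `|f y - f x - L (y - x)| <= e * `|y - x|.

Definition fderiv U (F : normedModType R) (f : E -> F) (x : E) : clinear E F :=
  get (is_fderiv U f x).

(* The derivatives f^(j) are obtained by iterating fderiv, so that f^(j) takes
   its values in clinear E (clinear E ...): its norm there is the operator norm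
   of the associated j-linear map. *)
Fixpoint smooth m U (F : normedModType R) (f : E -> F) : Prop :=
  if m is m'.+1 then
    (forall x, U x -> exists L, is_fderiv U f x L) /\ smooth m' U (fderiv U f)
  else {within U, continuous f}.

(* Supremum in [0, +oo], so that the supremum of the empty set is 0. *)
Definition nnsup (A : set (\bar R)) : \bar R := ereal_sup (A `|` [set 0%E]).

Definition holder_seminorm alpha U (F : normedModType R) (f : E -> F) : \bar R :=
  nnsup [set (`|f p.1 - f p.2| / `|p.1 - p.2| `^ alpha)%:E |
         p in [set p : E * E | [/\ U p.1, U p.2 & p.1 <> p.2]]].

(* With s = m + alpha and 0 < alpha <= 1, Cseminorm m alpha and Cnorm m alpha
   are ||.||^-_{C^s(U)} and ||.||_{C^s(U)}, meaningful for f in C^m(U). *)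
Fixpoint Cseminorm m alpha U (F : normedModType R) (f : E -> F) : \bar R :=
  if m is m'.+1 then
    maxe (holder_seminorm 1 U f) (Cseminorm m' alpha U (fderiv U f))
  else holder_seminorm alpha U f.

Definition Cnorm m alpha U (F : normedModType R) (f : E -> F) : \bar R :=
  maxe (nnsup [set `|f x|%:E | x in U]) (Cseminorm m alpha U f).

Definition Cspace m alpha U (F : normedModType R) (f : E -> F) : Prop :=
  smooth m U f /\ (Cnorm m alpha U f < +oo)%E.

(* The norms C^{s,0}(U x [0, 1]). *)
Definition Cseminorm0 m alpha U (F : normedModType R) (V : E -> R -> F) : \bar R :=
  nnsup [set Cseminorm m alpha U (V ^~ t) | t in `[0, 1]].

Definition Cnorm0 m alpha U (F : normedModType R) (V : E -> R -> F) : \bar R :=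
  nnsup [set Cnorm m alpha U (V ^~ t) | t in `[0, 1]].

End smoothness.

Lemma is_fderivE (R : realType) (E F : normedModType R) (U : set E)
    (f : E -> F) (x : E) (L : clinear E F) : open U -> U x ->
  is_fderiv U f x L <-> differentiable f x /\ 'd f x = L :> (E -> F).
Proof.
move=> oU Ux.
have nbE : within U (nbhs x) = nbhs x.
  apply/funext => A; apply/propext; rewrite /within; split => [UA|nA].
    have nU : nbhs x U by exact: open_nbhs_nbhs.
    by apply: filterS2 nU UA => y Uy; apply.
  by apply: filterS nA.
have littleoP (M : {linear E -> F}) : (forall e : R, 0 < e ->
    \forall y \near nbhs x, `|f y - f x - M (y - x)| <= e * `|y - x|) <->
    (fun h => f (h + x) - f x - M h) =o_ 0 id.
  split=> [H|/eqoP H e e0].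
    apply/eqoP => e e0; have /nbhs0P := H e e0; apply: filterS => h /=.
    by rewrite [x + h]addrC addrK.
  apply/nbhs0P; have := H e e0; apply: filterS => h /=.
  by rewrite [x + h]addrC addrK.
rewrite /is_fderiv nbE; split.
  move=> /(littleoP L) H.
  have dfL : 'd f x = L :> (E -> F).
    apply: diff_unique; first exact: clinear_continuous.
    apply/eqaddoP; move: H => /eqoP H e e0; apply: filterS (H e e0) => h.
    by rewrite /= !fctE /= opprD addrA.
  split=> //; apply/diff_locallyP; split.
    by rewrite dfL; exact: clinear_continuous.
  apply/eqaddoP; move: H => /eqoP H e e0; apply: filterS (H e e0) => h.
  by rewrite /= !fctE /= dfL opprD addrA.
move=> [/diff_locally df dfL]; apply/(littleoP L); apply/eqoP => e e0.
move/eqaddoP : df => /(_ e e0); apply: filterS => h.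
by rewrite /= !fctE /= dfL opprD addrA.
Qed.

Notation borel E := (g_sigma_algebraType (@open E)).

Section statistics.
Context {R : realType}.

Section model.
Context {E : normedModType R} {d : measure_display} {S : measurableType d}.
Variables (Theta : set E) (P : E -> probability S R) (est : {mfun S >-> borel E}).

(* The distribution P(theta; .) of the estimator, as a measure on the Borel sets
   of E; P theta is relevant for theta in Theta only. *)
Definition est_law (theta : E) : probability (borel E) R :=
  distribution (P theta) est.

Definition is_estimator : Prop :=
  (forall x, Theta (est x)) /\
  (forall A : set (borel E), measurable A ->
     measurable_fun (Theta : set (borel E)) (est_law^~ A)).

Definition Top (g : E -> R) (theta : E) : R :=
  (\int[est_law theta]_(t in Theta) g t)%R.

Definition Bop (g : E -> R) (theta : E) : R := Top g theta - g theta.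

Section homotopy.
Context {d' : measure_display} {Omega : measurableType d'}.
Variables (Q : probability Omega R) (H : E -> R -> Omega -> E).

Record random_homotopy : Prop := RandomHomotopy {
  homotopy_measurable : forall theta (t : R), Theta theta -> t \in `[0, 1] ->
    measurable_fun setT (H theta t : Omega -> borel E) ;
  homotopy_in : forall theta (t : R) w, Theta theta -> t \in `[0, 1] ->
    Theta (H theta t w) ;
  homotopy_continuous : \forall w \ae Q,
    {within Theta `*` `[0, 1], continuous (fun z : E * R => H z.1 z.2 w)} ;
  homotopy0 : forall theta w, Theta theta -> H theta 0 w = theta ;
  homotopy1 : forall theta, Theta theta ->
    forall A : set (borel E), measurable A ->
      Q (H theta 1 @^-1` A) = est_law theta A }.

Definition homotopy_smooth (m : nat) : Prop := \forall w \ae Q,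
  @smooth R (E * R)%type m (Theta `*` `[0, 1]) E (fun z : E * R => H z.1 z.2 w).

Definition Hdot (w : Omega) (theta : E) (t : R) : E :=
  @fderiv R R `[0, 1] E (fun u : R => H theta u w) t 1.

(* E (||H||^- \/ 1)^r ||dH/dt|| with r = m + alpha and the norms C^{r,0}.
   The integral of a nonnegative function is the supremum of the integrals of
   the simple functions below it, so it is defined even if the norms, which are
   suprema over uncountable sets, fail to be measurable. *)
Definition homotopy_moment (m : nat) (alpha : R) : \bar R :=
  (\int[Q]_w
     ((maxe (Cseminorm0 m alpha Theta (fun theta t => H theta t w)) 1)
        `^ (m%:R + alpha) *
      Cnorm0 m alpha Theta (Hdot w)))%E.

End homotopy.
End model.
End statistics.

(* Main.v *)
Require Import Defs.
From HB Require Import structures.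
From mathcomp Require Import all_boot all_order all_algebra.
From mathcomp Require Import all_classical all_reals all_analysis.
From mathcomp Require Import measurable_realfun.
From mathcomp Require Import ring.

Set Implicit Arguments.
Unset Strict Implicit.
Unset Printing Implicit Defensive.
Import Order.TTheory GRing.Theory Num.Theory.
Import numFieldNormedType.Exports.
Local Open Scope classical_set_scope.
Local Open Scope ring_scope.

(** One application of the bias operator B costs one derivative and one factor M, the
    moment of the homotopy: if g is in C^(m+1+rho) with 1 <= m <= k, then B g is in
    C^(m+rho), with norm at most a constant times M times the norm of g ([Bop_step]).
    After j <= k applications f of class C^(k+1+rho) has become B^j f of class
    C^(k+1-j+rho), and 1 <= k+1-j; going down to C^(1+rho) costs a power of 2
    ([Cs_le_dropn]).

    For one step, B g (theta) is the expectation of the increment of g along the random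
    path from theta to H(theta; 1). Almost every path is smooth, and there the increment
    is the integral over [0, 1] of the speed g'(H(theta; t)) applied to the time
    derivative of H ([path_ftc]). For fixed t and fixed path, the chain rule and the
    product rule ([Cs_le_comp], [Cs_le_prod]) bound the C^(m+rho) norm of the speed, as
    a function of theta, by a constant times the norm of g times the integrand of the
    moment. This integrand involves norms of level k+rho, which dominate those of
    level m+rho up to a power of 2. The bounds then have to be integrated in t and in
    the random parameter, and both integrations are instances of [Cs_le_integral]:
    a function with an integrable bound on its C^(m+rho) norm in theta may be
    differentiated under the integral, and the integral of the bounds bounds the
    integral.

    Two points are delicate. First, the derivatives take values in spaces of multilinear
    forms on a Banach space that may be nonseparable, where they need not be strongly
    measurable. They are integrated weakly: a linear map is recovered from the integrals
    of its values, by induction on the order of differentiation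
    ([test_family_clinear]), and norms are computed by testing against functionals.
    Second, the integrand N of the moment is a supremum over an uncountable set and may
    fail to be measurable, so that its integral is a lower one. The increments and
    differences that are integrated are real and measurable, and |u| <= N suffices for
    the integral of |u| to be at most that of N ([dominated_lower]). But N may be
    infinite on a set that is not negligible; on it there is no bound, and the flag of
    [Cs_le] keeps only the differentiability of the path. *)

(** * Continuous linear maps *)

Section clinear_constructions.
Context {R : realType}.

Lemma bounded_linear_clinear (E F : normedModType R) (f : E -> F) (C : R) :
  linear f -> (forall x, `|f x| <= C * `|x|) -> f \in @clinear_pred R E F.
Proof.
move=> lf bf; rewrite inE; split=> // x.
pose L := HB.pack_for {linear E -> F} f (GRing.isLinear.Build R E F *:%R f lf).
apply: (@bounded_linear_continuous R E F L).
apply/linear_boundedP; exists C; split; first exact: num_real.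
by move=> r Cr y; apply: (le_trans (bf y)); rewrite ler_wpM2r// ltW.
Qed.

Definition mk_clinear (E F : normedModType R) (f : E -> F) (C : R) (lf : linear f)
  (bf : forall x, `|f x| <= C * `|x|) : clinear E F := CLinear (bounded_linear_clinear lf bf).

Lemma clinear_normP (E F : normedModType R) (L : clinear E F) x :
  `|L x| <= `|L| * `|x|.
Proof. exact: opnormP. Qed.

Lemma clinear_norm_le (E F : normedModType R) (L : clinear E F) (C : R) :
  0 <= C -> (forall x, `|L x| <= C * `|x|) -> `|L| <= C.
Proof.
move=> C0 LC; apply: opnorm_le => x x1; apply: (le_trans (LC x)).
by rewrite ler_piMr.
Qed.

Lemma clinearP (E F : normedModType R) (L M : clinear E F) : L =1 M -> L = M.
Proof. by move=> LM; apply/val_inj/funext. Qed.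

(** These instances of [linearD] and its companions are tied to one map: the generic
    rules also rewrite with the opposite, which is linear as well. *)
Lemma clinear_add (E F : normedModType R) (L : clinear E F) x y : L (x + y) = L x + L y.
Proof. exact: linearD. Qed.

Lemma clinear_sub (E F : normedModType R) (L : clinear E F) x y : L (x - y) = L x - L y.
Proof. exact: linearB. Qed.

Lemma clinear_scale (E F : normedModType R) (L : clinear E F) a x : L (a *: x) = a *: L x.
Proof. exact: linearZ. Qed.

Lemma clinear_zero (E F : normedModType R) (L : clinear E F) : L 0 = 0.
Proof. exact: linear0. Qed.

Section special_maps.
Variables E F : normedModType R.

Definition id_clinear : clinear E E.
Proof.
apply: (@mk_clinear E E id 1); first by [].
by move=> x; rewrite mul1r.
Defined.

Definition line_clinear (h : E) : clinear R E.
Proof.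
apply: (@mk_clinear R E (fun s => s *: h) `|h|).
  by move=> a s t; rewrite scalerDl scalerA.
by move=> s; rewrite normrZ mulrC.
Defined.

Definition eval_clinear (h : E) : clinear (clinear E F) F.
Proof.
apply: (@mk_clinear (clinear E F) F (fun L => L h) `|h|); first by [].
by move=> L; rewrite mulrC; exact: clinear_normP.
Defined.

Definition inl_clinear : clinear E (E * R)%type.
Proof.
apply: (@mk_clinear E (E * R)%type (fun x => (x, 0)) 1).
  by move=> a x y; congr (_, _); rewrite /= scaler0 addr0.
by move=> x; rewrite mul1r prod_normE/= normr0 ge_max lexx/=.
Defined.

Definition inr_clinear : clinear R (E * R)%type.
Proof.
apply: (@mk_clinear R (E * R)%type (fun s => (0, s)) 1).
  by move=> a x y; congr (_, _); rewrite /= scaler0 addr0.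
by move=> x; rewrite mul1r prod_normE/= normr0 ge_max lexx/= andbT.
Defined.

End special_maps.

Section composition.
Variables E F G : normedModType R.

Lemma clinear_comp_linear (M : clinear F G) (L : clinear E F) : linear (M \o L).
Proof. by move=> a x y /=; rewrite !linearP. Qed.

Lemma clinear_comp_bound (M : clinear F G) (L : clinear E F) x :
  `|(M \o L) x| <= `|M| * `|L| * `|x|.
Proof.
apply: (le_trans (clinear_normP _ _)).
by rewrite -mulrA ler_wpM2l// clinear_normP.
Qed.

Definition clinear_comp (M : clinear F G) (L : clinear E F) : clinear E G :=
  mk_clinear (clinear_comp_linear M L) (clinear_comp_bound M L).

End composition.
End clinear_constructions.
Arguments id_clinear {R E}.
Arguments line_clinear {R E} h.
Arguments eval_clinear {R E} F h.
Arguments inl_clinear {R E}.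
Arguments inr_clinear {R E}.

(** * Derivatives within a set *)

Section fderiv_calculus.
Context {R : realType}.

Lemma is_fderivP (E F : normedModType R) (U : set E) (f : E -> F) x (L : clinear E F) :
  is_fderiv U f x L <->
  forall e : R, 0 < e -> exists2 d : R, 0 < d & forall y, U y -> `|y - x| < d ->
    `|f y - f x - L (y - x)| <= e * `|y - x|.
Proof.
split=> H e e0.
  have /nbhs_normP[d /= d0 Hd] := H e e0.
  by exists d => // y Uy yx; apply: Hd => //=; rewrite /ball_/= distrC.
have [d d0 Hd] := H e e0; apply/nbhs_normP; exists d => //= y.
by rewrite /ball_/= distrC => yx Uy; exact: Hd.
Qed.

Lemma is_fderiv_ext (E F : normedModType R) (U : set E) (f g : E -> F) x (L : clinear E F) :
  U x -> (forall y, U y -> f y = g y) -> is_fderiv U f x L -> is_fderiv U g x L.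
Proof.
move=> Ux fg /is_fderivP H; apply/is_fderivP => e /H[d d0 Hd].
by exists d => // y Uy yd; rewrite -!fg//; exact: Hd.
Qed.

Lemma is_fderiv_subset (E F : normedModType R) (U V : set E) (f : E -> F) x
    (L : clinear E F) : V `<=` U -> is_fderiv U f x L -> is_fderiv V f x L.
Proof.
move=> VU /is_fderivP H; apply/is_fderivP => e /H[d d0 Hd].
by exists d => // y /VU Uy; exact: Hd.
Qed.

(** Continuity at x with a linear rate, the form in which the chain and product rules
    use it. *)
Lemma is_fderiv_growth (E F : normedModType R) (U : set E) (f : E -> F) x (L : clinear E F) :
  is_fderiv U f x L -> exists2 d : R, 0 < d & forall y, U y -> `|y - x| < d ->
    `|f y - f x| <= (`|L| + 1) * `|y - x|.
Proof.
move=> /is_fderivP /(_ 1 ltr01)[d d0 Hd]; exists d => // y Uy yd.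
rewrite -[f y - f x](subrK (L (y - x))) mulrDl addrC.
by rewrite (le_trans (ler_normD _ _))// lerD ?clinear_normP// Hd.
Qed.

Lemma is_fderiv_continuous (E F : normedModType R) (U : set E) (f : E -> F) :
  (forall x, U x -> exists L, is_fderiv U f x L) -> {within U, continuous f}.
Proof.
move=> df; apply/subspace_continuousP => x Ux.
have [L /is_fderiv_growth[d d0 Hd]] := df _ Ux.
apply/cvgrPdist_le => e e0.
have L1 : 0 < `|L| + 1 by rewrite ltr_wpDl.
apply/nbhs_normP; exists (Num.min d (e / (`|L| + 1))).
  by rewrite /= lt_min d0 divr_gt0.
move=> y; rewrite /ball_/= lt_min => /andP[yd ye] Uy.
rewrite distrC in yd; rewrite distrC (le_trans (Hd _ Uy yd))//.
by rewrite mulrC -ler_pdivlMr// distrC ltW.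
Qed.

(** A derivative within U is determined along the directions in which U accumulates at
    x. This covers open sets, and the endpoints of [0, 1] where it is one-sided. *)
Lemma is_fderiv_unique_dir (E F : normedModType R) (U : set E) (f : E -> F) x
    (L M : clinear E F) (h : E) :
  (forall d : R, 0 < d -> exists2 s : R, s != 0 & U (x + s *: h) /\ `|s *: h| < d) ->
  is_fderiv U f x L -> is_fderiv U f x M -> L h = M h.
Proof.
move=> hU /is_fderivP HL /is_fderivP HM.
apply/eqP; rewrite -subr_eq0 -normr_le0; apply/ler_addgt0Pl => e e0.
rewrite addr0.
have [h0|h0] := eqVneq h 0.
  by rewrite h0 !clinear_zero subr0 normr0 ltW.
have nh : 0 < `|h| by rewrite normr_gt0.
have e2 : 0 < e / `|h| / 2 by rewrite !divr_gt0.
have [d1 d10 H1] := HL _ e2; have [d2 d20 H2] := HM _ e2.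
have [|s s0 [Us sd]] := hU (Num.min d1 d2); first by rewrite lt_min d10.
move: sd; rewrite lt_min => /andP[sd1 sd2].
have := H1 _ Us; have := H2 _ Us; rewrite [x + _]addrC addrK => /(_ sd2) A2 /(_ sd1) A1.
have : `|L (s *: h) - M (s *: h)| <= e / `|h| * `|s *: h|.
  rewrite -[L _ - M _](_ : (f (s *: h + x) - f x - M (s *: h)) -
     (f (s *: h + x) - f x - L (s *: h)) = _); last first.
    by rewrite opprB addrC addrA subrK.
  rewrite (le_trans (ler_normB _ _))// (le_trans (lerD A2 A1))// -mulrDl.
  by rewrite -splitr.
rewrite !clinear_scale -scalerBr !normrZ mulrCA ler_pM2l ?normr_gt0//.
by rewrite divfK// gt_eqF.
Qed.

Lemma open_norm_ball (E : normedModType R) (U : set E) x : open U -> U x ->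
  exists2 d : R, 0 < d & forall y, `|y - x| < d -> U y.
Proof.
move=> oU Ux; have /nbhs_normP[d /= d0 Hd] : nbhs x U by exact: open_nbhs_nbhs.
by exists d => // y yx; apply: Hd; rewrite /ball_/= distrC.
Qed.

Lemma open_dir (E : normedModType R) (U : set E) x h : open U -> U x ->
  forall d : R, 0 < d -> exists2 s : R, 0 < s & U (x + s *: h) /\ `|s *: h| < d.
Proof.
move=> oU Ux d d0; have [r r0 Ur] := open_norm_ball oU Ux.
have m0 : 0 < Num.min d r by rewrite lt_min d0.
have h1 : 0 < `|h| + 1 by rewrite ltr_wpDl.
have sm : `|(Num.min d r / (`|h| + 1)) *: h| < Num.min d r.
  rewrite normrZ gtr0_norm ?divr_gt0// mulrAC ltr_pdivrMr// ltr_pM2l//.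
  by rewrite ltrDl.
exists (Num.min d r / (`|h| + 1)); first exact: divr_gt0.
move: sm; rewrite lt_min => /andP[-> sr]; split=> //; apply: Ur.
by rewrite [x + _]addrC addrK.
Qed.

Lemma is_fderiv_unique (E F : normedModType R) (U : set E) (f : E -> F) x
    (L M : clinear E F) : open U -> U x ->
  is_fderiv U f x L -> is_fderiv U f x M -> L = M.
Proof.
move=> oU Ux HL HM; apply: clinearP => h.
apply: (is_fderiv_unique_dir _ HL HM) => d d0.
by have [s s0 H] := open_dir h oU Ux d0; exists s => //; rewrite gt_eqF.
Qed.

(** Through this bound the Lipschitz constants that make up the seminorm control the
    sup norms of all derivatives of positive order. *)
Lemma is_fderiv_norm_le (E F : normedModType R) (U : set E) (f : E -> F) x
    (L : clinear E F) (K : R) : open U -> U x -> 0 <= K -> is_fderiv U f x L ->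
  (forall y, U y -> `|f y - f x| <= K * `|y - x|) -> `|L| <= K.
Proof.
move=> oU Ux K0 /is_fderivP HL fK; apply: clinear_norm_le => // h.
have [->|h0] := eqVneq h 0; first by rewrite clinear_zero !normr0 mulr0.
have nh : 0 < `|h| by rewrite normr_gt0.
rewrite -ler_pdivrMr//; apply/ler_addgt0Pl => e e0.
have [d d0 Hd] := HL _ e0; have [s s0 [Us sd]] := open_dir h oU Ux d0.
have := Hd _ Us; have := fK _ Us; rewrite [x + _]addrC addrK => A1 /(_ sd) A2.
have : `|L (s *: h)| <= (e + K) * `|s *: h|.
  rewrite -[L _](_ : (f (s *: h + x) - f x) -
     (f (s *: h + x) - f x - L (s *: h)) = _); last first.
    by rewrite subKr.
  by rewrite (le_trans (ler_normB _ _))// addrC mulrDl lerD.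
by rewrite clinear_scale !normrZ mulrCA ler_pM2l ?normr_gt0 ?gt_eqF// ler_pdivrMr.
Qed.

Lemma is_fderivD (E F : normedModType R) (U : set E) (f g : E -> F) x (L M : clinear E F) :
  is_fderiv U f x L -> is_fderiv U g x M -> is_fderiv U (fun y => f y + g y) x (L + M).
Proof.
move=> /is_fderivP HL /is_fderivP HM; apply/is_fderivP => e e0.
have e2 : 0 < e / 2 by rewrite divr_gt0.
have [d1 d10 H1] := HL _ e2; have [d2 d20 H2] := HM _ e2.
exists (Num.min d1 d2); first by rewrite lt_min d10.
move=> y Uy; rewrite lt_min => /andP[/(H1 _ Uy) A1 /(H2 _ Uy) A2].
rewrite clinearD (_ : _ - _ = (f y - f x - L (y - x)) + (g y - g x - M (y - x))).
  by rewrite (le_trans (ler_normD _ _))// (splitr e) mulrDl lerD.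
by rewrite addrACA -opprD [f y - f x + _]addrACA -opprD.
Qed.

Lemma is_fderiv_comp (E F G : normedModType R) (U : set E) (V : set F) (f : F -> G)
    (g : E -> F) x (L : clinear F G) (M : clinear E F) :
  (forall y, U y -> V (g y)) -> U x ->
  is_fderiv V f (g x) L -> is_fderiv U g x M -> is_fderiv U (f \o g) x (clinear_comp L M).
Proof.
move=> UV Ux /is_fderivP HL HM'; have /is_fderiv_growth[d3 d30 H3] := HM'.
move: HM' => /is_fderivP HM; apply/is_fderivP => e e0.
have M1 : 0 < `|M| + 1 by rewrite ltr_wpDl.
have L1 : 0 < `|L| + 1 by rewrite ltr_wpDl.
have e1 : 0 < e / 2 / (`|M| + 1) by rewrite !divr_gt0.
have e2 : 0 < e / 2 / (`|L| + 1) by rewrite !divr_gt0.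
have [d1 d10 H1] := HL _ e1; have [d2 d20 H2] := HM _ e2.
exists (Num.min (d1 / (`|M| + 1)) (Num.min d2 d3)).
  by rewrite !lt_min d20 d30 divr_gt0.
move=> y Uy; rewrite !lt_min => /and3P[yd1 yd2 yd3].
have A3 := H3 _ Uy yd3.
have /(H1 _ (UV _ Uy)) A1 : `|g y - g x| < d1.
  by rewrite (le_lt_trans A3)// mulrC -ltr_pdivlMr.
have A2 := H2 _ Uy yd2.
rewrite /= (_ : _ - _ = (f (g y) - f (g x) - L (g y - g x)) +
   L (g y - g x - M (y - x))); last first.
  by rewrite [L (_ - M _)]clinear_sub addrA subrK.
rewrite (le_trans (ler_normD _ _))// (splitr e) mulrDl lerD//.
  rewrite (le_trans A1)// (le_trans (ler_wpM2l (ltW e1) A3))//.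
  by rewrite mulrA divfK// gt_eqF.
rewrite (le_trans (clinear_normP _ _))//.
rewrite (le_trans (ler_wpM2l (normr_ge0 L) A2))// mulrA ler_wpM2r//.
rewrite mulrCA ler_piMr ?divr_ge0 ?(ltW e0)// ler_pdivrMr// mul1r.
by rewrite lerDl.
Qed.

Lemma is_fderiv_clinear (E F : normedModType R) (U : set E) (L : clinear E F) x :
  is_fderiv U L x L.
Proof.
apply/is_fderivP => e e0; exists 1 => // y _ _.
by rewrite clinear_sub subrr normr0 mulr_ge0// ltW.
Qed.

Lemma is_fderiv_affine (E F : normedModType R) (U : set E) (L : clinear E F) (c : F) x :
  is_fderiv U (fun y => L y + c) x L.
Proof.
apply/is_fderivP => e e0; exists 1 => // y _ _.
by rewrite clinear_sub opprD addrACA subrr addr0 subrr normr0 mulr_ge0// ltW.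
Qed.

End fderiv_calculus.

(** * Bounded bilinear maps *)

Section bilinear.
Context {R : realType}.

(** Norm at most 1 is the case of the products needed here: composition of linear
    maps, and evaluation of a linear map at a vector. *)
Record cbilin (F1 F2 F3 : normedModType R) (B : F1 -> F2 -> F3) : Prop := CBilin {
  cbilinl : forall v, linear (B^~ v) ;
  cbilinr : forall u, linear (B u) ;
  cbilin_le : forall u v, `|B u v| <= `|u| * `|v| }.

Section partials.
Variables (E F1 F2 F3 : normedModType R) (B : F1 -> F2 -> F3) (cB : cbilin B).

Lemma cbilinBl u u' v : B (u - u') v = B u v - B u' v.
Proof. by have /= := cbilinl cB v (-1) u' u; rewrite !scaleN1r (addrC u) => ->; rewrite addrC. Qed.

Lemma cbilinBr u v v' : B u (v - v') = B u v - B u v'.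
Proof. by have /= := cbilinr cB u (-1) v' v; rewrite !scaleN1r (addrC v) => ->; rewrite addrC. Qed.

Lemma cbilinl_linear (L : clinear E F1) v : linear (fun h => B (L h) v).
Proof. by move=> a x y; rewrite clinear_add clinear_scale; exact: (cbilinl cB v). Qed.

Lemma cbilinl_bound (L : clinear E F1) v h : `|B (L h) v| <= `|L| * `|v| * `|h|.
Proof.
rewrite (le_trans (cbilin_le cB _ _))// mulrAC ler_wpM2r//.
exact: clinear_normP.
Qed.

Lemma cbilinr_linear u (L : clinear E F2) : linear (fun h => B u (L h)).
Proof. by move=> a x y; rewrite clinear_add clinear_scale; exact: (cbilinr cB u). Qed.

Lemma cbilinr_bound u (L : clinear E F2) h : `|B u (L h)| <= `|u| * `|L| * `|h|.
Proof.
rewrite (le_trans (cbilin_le cB _ _))// -mulrA ler_wpM2l//.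
exact: clinear_normP.
Qed.

(** [partl] and [partr] are the two terms of the product rule. Being bilinear of norm
    at most 1 themselves, they let the product estimate be iterated over the order of
    differentiation. *)
Definition partl (L : clinear E F1) (v : F2) : clinear E F3 :=
  mk_clinear (cbilinl_linear L v) (cbilinl_bound L v).

Definition partr (u : F1) (L : clinear E F2) : clinear E F3 :=
  mk_clinear (cbilinr_linear u L) (cbilinr_bound u L).

Lemma partl_cbilin : cbilin partl.
Proof.
split=> [v a L M|L a v w|L v].
- by apply: clinearP => h; exact: (cbilinl cB v).
- by apply: clinearP => h; exact: (cbilinr cB (L h)).
- by apply: clinear_norm_le; [rewrite mulr_ge0|exact: cbilinl_bound].
Qed.

Lemma partr_cbilin : cbilin partr.
Proof.
split=> [L a v w|v a L M|v L].
- by apply: clinearP => h; exact: (cbilinl cB (L h)).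
- by apply: clinearP => h; exact: (cbilinr cB v).
- by apply: clinear_norm_le; [rewrite mulr_ge0|exact: cbilinr_bound].
Qed.

(** The increment of a product minus its linear part, split into three small terms. *)
Let telescope_identity (a b c d e m : F3) :
  a - e - (d + m) = a - b - c + (c - d) + (b - e - m).
Proof.
rewrite [a - b - c + _]addrA subrK opprD [LHS]addrA [RHS]addrA; congr (_ - m).
by rewrite [a - b - d]addrAC addrA subrK addrAC.
Qed.

Lemma is_fderiv_bilin (U : set E) (f : E -> F1) (g : E -> F2) x
    (L : clinear E F1) (M : clinear E F2) : U x ->
  is_fderiv U f x L -> is_fderiv U g x M ->
  is_fderiv U (fun y => B (f y) (g y)) x (partl L (g x) + partr (f x) M).
Proof.
move=> Ux HL' HM'; have /is_fderiv_growth[d3 d30 H3] := HM'.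
move: HL' HM' => /is_fderivP HL /is_fderivP HM; apply/is_fderivP => e e0.
pose a := `|f x| + 1; pose c := `|g x| + `|M| + 2; pose l := `|L| + 1.
have a0 : 0 < a by rewrite ltr_wpDl.
have c0 : 0 < c by rewrite ltr_wpDl// addr_ge0.
have l0 : 0 < l by rewrite ltr_wpDl.
have M1 : 0 < `|M| + 1 by rewrite ltr_wpDl.
have ec : 0 < e / 3 / c by rewrite !divr_gt0.
have ea : 0 < e / 3 / a by rewrite !divr_gt0.
have el : 0 < e / 3 / l / (`|M| + 1) by rewrite !divr_gt0.
have [d1 d10 H1] := HL _ ec; have [d2 d20 H2] := HM _ ea.
exists (Num.min (Num.min 1 (e / 3 / l / (`|M| + 1))) (Num.min d1 (Num.min d2 d3))).
  by rewrite !lt_min d10 d20 d30 el ltr01.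
move=> y Uy; rewrite !lt_min -!andbA => /and5P[y1 ye yd1 yd2 yd3].
have A1 := H1 _ Uy yd1; have A2 := H2 _ Uy yd2; have A3 := H3 _ Uy yd3.
rewrite clinearD /= (_ : _ - _ = B (f y - f x - L (y - x)) (g y) +
   B (L (y - x)) (g y - g x) + B (f x) (g y - g x - M (y - x))); last first.
  by rewrite !cbilinBl !cbilinBr; exact: telescope_identity.
have gy : `|g y| <= c.
  rewrite -[g y](subrK (g x)) (le_trans (ler_normD _ _))// addrC /c -addrA lerD2l.
  rewrite (le_trans A3)// mulrDl mul1r lerD//.
    by rewrite ler_piMr// ltW.
  by rewrite (le_trans (ltW y1))// ler1n.
have e3 : e = e / 3 + e / 3 + e / 3 by field.
rewrite e3 !mulrDl (le_trans (ler_normD _ _))// lerD//.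
  rewrite (le_trans (ler_normD _ _))// lerD//.
    rewrite (le_trans (cbilin_le cB _ _))//.
    rewrite (le_trans (ler_pM _ _ A1 gy))// mulrAC divfK//.
    by rewrite gt_eqF.
  rewrite (le_trans (cbilin_le cB _ _))//.
  have A4 : `|g y - g x| <= e / 3 / l.
    by rewrite (le_trans A3)// mulrC -ler_pdivlMr// ltW.
  rewrite (le_trans (ler_pM _ _ (clinear_normP L _) A4))//.
  rewrite mulrC mulrA ler_wpM2r// -[X in _ <= X](divfK (lt0r_neq0 l0)).
  by rewrite ler_wpM2l ?divr_ge0 ?(ltW e0) ?(ltW l0)// lerDl.
rewrite (le_trans (cbilin_le cB _ _))//.
rewrite (le_trans (ler_wpM2l (normr_ge0 (f x)) A2))// mulrA ler_wpM2r//.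
rewrite mulrC -[X in _ <= X](divfK (lt0r_neq0 a0)).
by rewrite ler_wpM2l ?divr_ge0 ?(ltW e0) ?(ltW a0)// lerDl.
Qed.

End partials.

Lemma clinear_comp_cbilin (E F G : normedModType R) : cbilin (@clinear_comp R E F G).
Proof.
split=> [L a M N|M a L N|M L].
- exact: clinearP.
- by apply: clinearP => h /=; rewrite clinear_add clinear_scale.
- by apply: clinear_norm_le; [rewrite mulr_ge0|exact: clinear_comp_bound].
Qed.

Lemma eval_cbilin (E F : normedModType R) : cbilin (fun (L : clinear E F) x => L x).
Proof.
split=> [v a L M|L a x y|L x] //; first by rewrite clinear_add clinear_scale.
exact: clinear_normP.
Qed.

End bilinear.

(** * Calculus of norm bounds *)

Section Cs_le.
Context {R : realType} {E : normedModType R}.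

Definition lip_le (b : bool) (U : set E) (F : normedModType R) (f : E -> F) (K : R) :=
  b -> forall x y, U x -> U y -> `|f x - f y| <= K * `|x - y|.

Definition sup_norm_le (b : bool) (U : set E) (F : normedModType R) (f : E -> F) (K : R) :=
  b -> forall x, U x -> `|f x| <= K.

(** The bound [Cseminorm m al U f <= K] for an m times differentiable f, with a flag
    that switches the bounds off: along the paths on which a norm is infinite,
    differentiability is all there is, and the same rules of calculus apply to it.
    When [b] is true and al > 0 the derivative of order m is continuous, being
    Hoelder. *)
Fixpoint Cs_le (b : bool) m (al : R) (U : set E) (F : normedModType R) (f : E -> F)
    (K : R) : Prop :=
  if m is m'.+1 then
    lip_le b U f K /\
    exists2 f' : E -> clinear E F,
      (forall x, U x -> is_fderiv U f x (f' x)) & Cs_le b m' al U f' K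
  else b -> forall x y, U x -> U y -> `|f x - f y| <= K * `|x - y| `^ al.

Lemma Cs_le_ext b m al U (F : normedModType R) (f g : E -> F) K :
  (forall x, U x -> f x = g x) -> Cs_le b m al U f K -> Cs_le b m al U g K.
Proof.
case: m => [|m] fg /= => [H bb x y Ux Uy|[H [f' df H']]].
  by rewrite -!fg//; exact: H.
split; first by move=> bb x y Ux Uy; rewrite -!fg//; exact: H.
by exists f' => // x Ux; apply: is_fderiv_ext (df _ Ux).
Qed.

Lemma Cs_leW b m al U (F : normedModType R) (f : E -> F) K K' :
  K <= K' -> Cs_le b m al U f K -> Cs_le b m al U f K'.
Proof.
move=> KK'; elim: m F f => [|m IH] F f /=.
  by move=> H bb x y Ux Uy; rewrite (le_trans (H bb _ _ Ux Uy))// ler_wpM2r ?powR_ge0.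
move=> [H [f' df H']]; split.
  by move=> bb x y Ux Uy; rewrite (le_trans (H bb _ _ Ux Uy))// ler_wpM2r.
by exists f' => //; exact: IH.
Qed.

Lemma Cs_leF b m al U (F : normedModType R) (f : E -> F) K K' :
  Cs_le b m al U f K -> Cs_le false m al U f K'.
Proof.
elim: m F f => [|m IH] F f //= [H [f' df H']]; split=> //.
by exists f' => //; exact: IH.
Qed.

Lemma Cs_leD b m al U (F : normedModType R) (f g : E -> F) K K' :
  Cs_le b m al U f K -> Cs_le b m al U g K' ->
  Cs_le b m al U (fun x => f x + g x) (K + K').
Proof.
have tri (F' : normedModType R) (p q p' q' : F') : `|p + q - (p' + q')| <= `|p - p'| + `|q - q'|.
  by rewrite opprD addrACA ler_normD.
elim: m F f g => [|m IH] F f g /=.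
  move=> H1 H2 bb x y Ux Uy; rewrite (le_trans (tri _ _ _ _ _))//.
  by rewrite mulrDl lerD ?H1 ?H2.
move=> [H1 [f' df Hf]] [H2 [g' dg Hg]]; split.
  move=> bb x y Ux Uy; rewrite (le_trans (tri _ _ _ _ _))//.
  by rewrite mulrDl lerD ?H1 ?H2.
exists (fun x => f' x + g' x); last exact: IH.
by move=> x Ux; apply: is_fderivD; [exact: df|exact: dg].
Qed.

Variables (U : set E) (al : R).
Hypotheses (oU : open U) (al01 : 0 < al <= 1).

Lemma fderiv_sup_norm_le b (F : normedModType R) (f : E -> F) f' K : 0 <= K ->
  (forall x, U x -> is_fderiv U f x (f' x)) -> lip_le b U f K -> sup_norm_le b U f' K.
Proof.
move=> K0 df H bb x Ux; apply: (is_fderiv_norm_le oU Ux K0 (df _ Ux)) => y Uy.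
exact: H.
Qed.

(** A bounded Lipschitz function is Hoelder: at distance at most 1 because |x - y| <=
    |x - y| `^ al, and beyond because a difference of two values is at most 2 K. *)
Lemma Cs_le_drop b m (F : normedModType R) (f : E -> F) K : 0 <= K ->
  sup_norm_le b U f K -> Cs_le b m.+1 al U f K -> Cs_le b m al U f (2 * K).
Proof.
case/andP: al01 => al0 al1 K0.
have K2 : K <= 2 * K by rewrite ler_peMl// ler1n.
elim: m F f => [|m IH] F f fK [H [f' df H']] /=.
  move=> bb x y Ux Uy.
  have [xy1|xy1] := leP `|x - y| 1; last first.
    rewrite (@le_trans _ _ (2 * K))//.
      by rewrite mulr_natl mulr2n (le_trans (ler_normB _ _))// lerD// fK.
    rewrite ler_peMr ?mulr_ge0// -(powRr0 `|x - y|) ler_powR ?(ltW xy1)//.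
    exact: ltW.
  rewrite (le_trans (H bb _ _ Ux Uy))// ler_pM//.
  have [->|xy0] := eqVneq (x - y) 0; first by rewrite normr0 powR_ge0.
  by rewrite ger1_powR// normr_gt0 xy0.
split.
  by move=> bb x y Ux Uy; rewrite (le_trans (H bb _ _ Ux Uy))// ler_wpM2r.
by exists f' => //; apply: IH => //; exact: fderiv_sup_norm_le H.
Qed.

Lemma Cs_le_dropn b m n (F : normedModType R) (f : E -> F) K : 0 <= K ->
  sup_norm_le b U f K -> Cs_le b (n + m) al U f K -> Cs_le b m al U f (2 ^+ n * K).
Proof.
elim: n K => [|n IH] K K0 fK; first by rewrite mul1r.
rewrite addSn exprSr -mulrA => H; apply: IH; first by rewrite mulr_ge0.
  by move=> bb x Ux; rewrite (le_trans (fK bb _ Ux))// ler_peMl// ler1n.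
exact: Cs_le_drop.
Qed.

(** Each differentiation costs 4: the product rule has two terms, and in each of them
    one factor is lowered by one level at the cost of 2. *)
Definition prod_cst m : R := 2 * 4 ^+ m.

(** By induction on m: the derivative of B f g is a sum of two products of the same
    kind, in which the undifferentiated factor is taken one level lower. *)
Lemma Cs_le_prod b m (F1 F2 F3 : normedModType R) (B : F1 -> F2 -> F3)
    (f : E -> F1) (g : E -> F2) A1 A2 : cbilin B -> 0 <= A1 -> 0 <= A2 ->
  sup_norm_le b U f A1 -> sup_norm_le b U g A2 ->
  Cs_le b m al U f A1 -> Cs_le b m al U g A2 ->
  Cs_le b m al U (fun x => B (f x) (g x)) (prod_cst m * A1 * A2).
Proof.
elim: m F1 F2 F3 B f g A1 A2 => [|m IH] F1 F2 F3 B f g A1 A2 cB A10 A20 fA gA.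
  rewrite /= /prod_cst expr0 mulr1 => Hf Hg bb x y Ux Uy.
  rewrite (_ : B _ _ - _ = B (f x - f y) (g x) + B (f y) (g x - g y)); last first.
    by rewrite (cbilinBl cB) (cbilinBr cB) addrA subrK.
  rewrite mulr_natl mulr2n !mulrDl (le_trans (ler_normD _ _))// lerD//.
    rewrite (le_trans (cbilin_le cB _ _))// mulrAC.
    by rewrite ler_pM ?Hf ?gA.
  by rewrite (le_trans (cbilin_le cB _ _))// -mulrA ler_pM ?Hg ?fA.
move=> Hf Hg; have Hf' := Cs_le_drop A10 fA Hf; have Hg' := Cs_le_drop A20 gA Hg.
move: Hf Hg => [Lf [f' df Cf]] [Lg [g' dg Cg]]; split.
  move=> bb x y Ux Uy.
  rewrite (_ : B _ _ - _ = B (f x - f y) (g x) + B (f y) (g x - g y)); last first.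
    by rewrite (cbilinBl cB) (cbilinBr cB) addrA subrK.
  apply: (@le_trans _ _ ((2 * A1 * A2) * `|x - y|)).
    rewrite mulr_natl mulr2n !mulrDl (le_trans (ler_normD _ _))// lerD//.
      rewrite (le_trans (cbilin_le cB _ _))// mulrAC.
      by rewrite ler_pM ?Lf ?gA.
    by rewrite (le_trans (cbilin_le cB _ _))// -mulrA ler_pM ?Lg ?fA.
  rewrite !ler_wpM2r// /prod_cst ler_peMr//.
  by rewrite exprn_ege1// ler1n.
exists (fun x => partl cB (f' x) (g x) + partr cB (f x) (g' x)).
  by move=> x Ux; apply: is_fderiv_bilin; [|exact: df|exact: dg].
have -> : prod_cst m.+1 * A1 * A2 = prod_cst m * A1 * (2 * A2) + prod_cst m * (2 * A1) * A2.
  by rewrite /prod_cst exprS; ring.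
have A1' : A1 <= 2 * A1 by rewrite ler_peMl// ler1n.
have A2' : A2 <= 2 * A2 by rewrite ler_peMl// ler1n.
apply: Cs_leD; apply: IH => //; rewrite ?mulr_ge0//.
- exact: partl_cbilin.
- exact: fderiv_sup_norm_le Lf.
- by move=> bb x Ux; rewrite (le_trans (gA bb _ Ux)).
- exact: partr_cbilin.
- by move=> bb x Ux; rewrite (le_trans (fA bb _ Ux)).
- exact: fderiv_sup_norm_le Lg.
Qed.

End Cs_le.

Section chain.
Context {R : realType} {E F : normedModType R}.
Variables (U : set E) (V : set F) (al : R).
Hypotheses (oU : open U) (oV : open V) (al01 : 0 < al <= 1).

(** One more level means one product of f' o h by h', after lowering the level of h,
    which replaces K by 2 K under an exponent m' + al <= m' + 1. *)
Fixpoint comp_cst m : R := if m is m'.+1 then prod_cst m' * comp_cst m' * 2 ^+ m'.+1 else 1.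

Lemma comp_cst_ge1 m : 1 <= comp_cst m.
Proof.
elim: m => //= m IH; rewrite mulr_ege1//; last by rewrite exprn_ege1// ler1n.
by rewrite mulr_ege1// /prod_cst mulr_ege1// ?exprn_ege1// ler1n.
Qed.

(** An outer function that is merely Hoelder asks for a Lipschitz inner one, which
    [Cs_le] records from level 1 on. The values of h themselves may be unbounded. *)
Definition inner_le b m (h : E -> F) K := lip_le b U h K /\
  (if m is m'.+1 then Cs_le b m al U h K else True).

Lemma inner_le_drop b m (h : E -> F) K : 0 <= K ->
  inner_le b m.+1 h K -> inner_le b m h (2 * K).
Proof.
move=> K0 [Lh H]; have K2 : K <= 2 * K by rewrite ler_peMl// ler1n.
have Lh' : lip_le b U h (2 * K).
  by move=> bb x y Ux Uy; rewrite (le_trans (Lh bb _ _ Ux Uy))// ler_wpM2r.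
case: m H => [|m] //= H; split=> //; split=> //.
have [_ [h' dh H']] := H; exists h' => //.
by apply: (@Cs_le_drop _ _ _ _ oU al01) => //; exact: fderiv_sup_norm_le Lh.
Qed.

(** Each derivative of f o h brings a factor K through h', and the last Hoelder bound
    turns the distance of h x and h y into K `^ al times that of x and y. *)
Lemma Cs_le_comp b m (G : normedModType R) (f : F -> G) (h : E -> F) A K :
  0 <= A -> 1 <= K -> (forall x, U x -> V (h x)) ->
  sup_norm_le b V f A -> Cs_le b m al V f A -> inner_le b m h K ->
  Cs_le b m al U (f \o h) (comp_cst m * A * K `^ (m%:R + al)).
Proof.
case/andP: al01 => al0 al1 A0; elim: m G f A A0 h K => [|m IH] G f A A0 h K K1 UV fA.
  rewrite mul1r add0r => Hf [Lh _] bb x y Ux Uy /=.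
  rewrite (le_trans (Hf bb _ _ (UV _ Ux) (UV _ Uy)))// -mulrA ler_wpM2l//.
  rewrite -powRM ?(le_trans ler01 K1)//.
  by rewrite ge0_ler_powR ?nnegrE ?mulr_ge0 ?(le_trans ler01 K1) ?(ltW al0) ?Lh.
have K0 : 0 <= K by rewrite (le_trans ler01).
move=> Hf Hh; have Hh' := inner_le_drop K0 Hh.
have pe : K `^ (m.+1%:R + al) = K `^ (m%:R + al) * K.
  rewrite -natr1 addrAC powRD ?powRr1//.
  by rewrite (gt_eqF (lt_le_trans ltr01 K1)) implybT.
have Kp : 1 <= K `^ (m%:R + al).
  by rewrite -[leLHS](powRr0 K) ler_powR// addr_ge0// ltW.
move: Hf Hh => [Lf [f' df Cf]] [Lh [_ [h' dh Ch]]]; split.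
  move=> bb x y Ux Uy.
  rewrite (le_trans (Lf bb _ _ (UV _ Ux) (UV _ Uy)))//.
  rewrite (le_trans (ler_wpM2l A0 (Lh bb _ _ Ux Uy)))// mulrA ler_wpM2r//.
  have Cm : 1 <= comp_cst m.+1 :> R by exact: comp_cst_ge1.
  rewrite pe [leRHS](_ : _ = comp_cst m.+1 * K `^ (m%:R + al) * (A * K)); last by ring.
  by rewrite ler_peMl ?mulr_ge0// mulr_ege1.
exists (fun x => clinear_comp (f' (h x)) (h' x)).
  by move=> x Ux; apply: (is_fderiv_comp UV Ux); [exact: df (UV _ Ux)|exact: dh].
have f'A := fderiv_sup_norm_le oV A0 df Lf.
have K1' : 1 <= 2 * K by rewrite mulr_ege1// ler1n.
have := IH _ _ _ A0 _ _ K1' UV f'A Cf Hh'.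
set A' := comp_cst m * A * (2 * K) `^ (m%:R + al) => Cfh.
have A'0 : 0 <= A'.
  by rewrite !mulr_ge0// ?powR_ge0// (le_trans ler01)// comp_cst_ge1.
have AA' : A <= A'.
  rewrite /A' mulrAC ler_peMl// mulr_ege1 ?comp_cst_ge1//.
  by rewrite -[leLHS](powRr0 (2 * K)) ler_powR// addr_ge0// ltW.
have fhA : sup_norm_le b U (f' \o h) A'.
  by move=> bb x Ux; rewrite (le_trans (f'A bb _ (UV _ Ux))).
have h'K := fderiv_sup_norm_le oU K0 dh Lh.
have := Cs_le_prod oU al01 (clinear_comp_cbilin E F G) A'0 K0 fhA h'K Cfh Ch.
apply: Cs_leW; rewrite pe /A' /= powRM//.
rewrite [leRHS](_ : _ = prod_cst m *
  (comp_cst m * A * (2 ^+ m.+1 * K `^ (m%:R + al))) * K); last by ring.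
rewrite ler_wpM2r// ler_wpM2l//.
  by rewrite mulr_ge0.
rewrite ler_wpM2l ?mulr_ge0 ?(le_trans ler01 (comp_cst_ge1 m))//.
rewrite ler_wpM2r ?powR_ge0// -powR_mulrn// ler_powR ?ler1n//.
by rewrite -natr1 lerD2l.
Qed.

End chain.

Section linear_change.
Context {R : realType}.

(** Restricts a function smooth in space and time jointly to slices, and evaluates its
    derivatives in a fixed direction. *)
Lemma Cs_le_affine (E E' F G : normedModType R) m al (U : set E) (V : set E')
   (g : E' -> F) (J : clinear E E') (c : E') (L : clinear F G) K :
  (forall x, U x -> V (J x + c)) ->
  Cs_le false m al V g K -> Cs_le false m al U (fun x => L (g (J x + c))) K.
Proof.
move=> UV; elim: m F G g L => [|m IH] F G g L //= [_ [g' dg Hg]]; split=> //.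
have lin : linear (fun M : clinear E' F => clinear_comp L (clinear_comp M J)).
  by move=> a M N; apply: clinearP => x /=; rewrite clinear_add clinear_scale.
have bd (M : clinear E' F) : `|clinear_comp L (clinear_comp M J)| <= (`|L| * `|J|) * `|M|.
  apply: clinear_norm_le; first by rewrite !mulr_ge0.
  move=> x /=; rewrite (le_trans (clinear_normP _ _))// -!mulrA ler_wpM2l//.
  rewrite (le_trans (clinear_normP _ _))// [leRHS]mulrCA ler_wpM2l//.
  exact: clinear_normP.
exists (fun x => mk_clinear lin bd (g' (J x + c))); last exact: IH.
move=> x Ux; apply: (is_fderiv_comp (V := setT)) => //; first exact: is_fderiv_clinear.
apply: (is_fderiv_comp UV Ux); first exact: dg (UV _ Ux).
exact: is_fderiv_affine.
Qed.

End linear_change.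

(** * Mean value inequality and weak integrals *)

Section mean_value.
Context {R : realType}.

Lemma is_fderiv_is_derive (f : R -> R) (a b s : R) (L : clinear R R) :
  a < s < b -> is_fderiv `[a, b] f s L -> is_derive s 1 f (L 1).
Proof.
move=> sab df.
have {df} : is_fderiv `]a, b[ f s L.
  by apply: is_fderiv_subset df; exact: subset_itv_oo_cc.
have oab : open (`]a, b[%classic : set R) by exact: itv_open.
have sU : `]a, b[%classic s by rewrite /= in_itv.
move=> /(is_fderivE f L oab sU)[df dL]; apply: DeriveDef.
  exact: diff_derivable.
by rewrite deriveE// dL.
Qed.

(** A pair (l, w) stands for a functional l with a bound w of its norm. With explicit
    weights the functionals L |-> l (L h) can be formed for every h, with weight w
    |h|, rather than on the unit ball only. *)
Definition norming (F : normedModType R) (Lam : set (clinear F R * R)) :=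
  forall y c, 0 <= c -> (forall l, Lam l -> `|l.1 y| <= c * l.2) -> `|y| <= c.

Definition bounded_by_weight (F : normedModType R) (Lam : set (clinear F R * R)) :=
  forall l, Lam l -> 0 <= l.2 /\ forall y, `|l.1 y| <= l.2 * `|y|.

(** Testing against a norming family reduces this to the mean value theorem for a real
    function on the segment from x to y. *)
Lemma mean_value_le (E F : normedModType R) (U : set E) (g : E -> F) (g' : E -> clinear E F)
    (Lam : set (clinear F R * R)) x y C :
  norming Lam -> bounded_by_weight Lam -> 0 <= C ->
  (forall s : R, 0 <= s <= 1 -> U (s *: (y - x) + x)) ->
  (forall z, U z -> is_fderiv U g z (g' z)) ->
  (forall s : R, 0 <= s <= 1 -> `|g' (s *: (y - x) + x)| <= C) ->
  `|g y - g x| <= C * `|y - x|.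
Proof.
move=> nL wL C0 seg dg gC; apply: nL => [|l Ll]; first by rewrite mulr_ge0.
have [l20 lw] := wL _ Ll.
pose p (s : R) := line_clinear (y - x) s + x.
have segp (s : R) : `[0, 1]%classic s -> U (p s) by rewrite /= in_itv/= => /seg.
pose psi s := l.1 (g (p s)).
pose dpsi s := clinear_comp l.1 (clinear_comp (g' (p s)) (line_clinear (y - x))).
have dpsiP (s : R) : `[0, 1]%classic s -> @is_fderiv R R `[0, 1] R psi s (dpsi s).
  move=> s01; apply: (is_fderiv_comp (V := setT)) => //; first exact: is_fderiv_clinear.
  apply: (is_fderiv_comp segp s01); first exact: dg (segp _ s01).
  exact: is_fderiv_affine.
have [|||s s01] := @MVT R psi (fun s => dpsi s 1) 0 1.
- exact: ltr01.
- move=> s; rewrite in_itv/= => s01; apply: (@is_fderiv_is_derive psi 0 1 s (dpsi s) s01).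
  by apply: dpsiP; rewrite /= in_itv/=; case/andP: s01 => /ltW-> /ltW->.
- by apply: is_fderiv_continuous => s s01; exists (dpsi s); exact: dpsiP.
rewrite subr0 mulr1 /psi /p /= scale1r subrK scale0r add0r [l.1 (_ - _)]clinear_sub => ->.
move: s01; rewrite in_itv/= => /andP[/ltW s0 /ltW s1].
rewrite (le_trans (lw _))// mulrC ler_wpM2r//.
rewrite (le_trans (clinear_normP _ _))// ler_wpM2r//.
by apply: gC; rewrite s0.
Qed.

End mean_value.

Section weak_integral.
Context {R : realType} {d : measure_display} {T : measurableType d}.
Variables (mu : {measure set T -> \bar R}) (D : set T) (b : T -> bool) (K : T -> R) (M : R).
Hypothesis mD : measurable D.
Hypothesis K0 : forall t, 0 <= K t.
Hypothesis M0 : 0 <= M.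

(** K is an integrable majorant with integral M, infinite where [b] is false;
    everything used of it is this consequence, which makes sense for a majorant that
    is not measurable. *)
Definition dominated := forall (u : T -> R) (c : R), 0 <= c -> measurable_fun D u ->
  (forall t, D t -> b t -> `|u t| <= c * K t) ->
  mu.-integrable D (EFin \o u) /\ `|\int[mu]_(t in D) u t|%R <= c * M.

Hypothesis dom : dominated.

(** Weak (Pettis) integrals of dominated functions exist in F. *)
Definition representing (F : normedModType R) (Lam : set (clinear F R * R)) :=
  forall (phi : T -> F) c, 0 <= c ->
    (forall l, Lam l -> measurable_fun D (fun t => l.1 (phi t))) ->
    (forall t, D t -> b t -> `|phi t| <= c * K t) ->
    exists y, forall l, Lam l -> l.1 y = (\int[mu]_(t in D) l.1 (phi t))%R.

Record test_family (F : normedModType R) (Lam : set (clinear F R * R)) : Prop := TestFamily {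
  tf_norming : norming Lam ;
  tf_weight : bounded_by_weight Lam ;
  tf_representing : representing Lam }.

Lemma test_family_eq (F : normedModType R) (Lam : set (clinear F R * R)) (x y : F) :
  test_family Lam -> (forall l, Lam l -> l.1 x = l.1 y) -> x = y.
Proof.
move=> tL xy; apply/eqP; rewrite -subr_eq0 -normr_le0.
apply: (tf_norming tL) => // l Ll.
by rewrite clinear_sub xy// subrr normr0 mul0r.
Qed.

Lemma test_family_real : test_family [set (id_clinear, 1 : R)].
Proof.
split.
- by move=> y c c0 /(_ _ erefl) /=; rewrite mulr1.
- by move=> l /= ->; split=> // y; rewrite mul1r.
- by move=> phi c c0 _ _; exists (\int[mu]_(t in D) phi t)%R => l /= ->.
Qed.

Definition lift_tests (E F : normedModType R) (Lam : set (clinear F R * R)) :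
    set (clinear (clinear E F) R * R) :=
  [set (clinear_comp p.1.1 (eval_clinear F p.2), p.1.2 * `|p.2|) | p in [set p : _ * E | Lam p.1]].

Arguments lift_tests E {F} Lam.

Lemma lift_testsP (E F : normedModType R) (Lam : set (clinear F R * R)) l (h : E) :
  Lam l -> lift_tests E Lam (clinear_comp l.1 (eval_clinear F h), l.2 * `|h|).
Proof. by move=> Ll; exists (l, h). Qed.

(** The weak integral of linear maps phi t is formed pointwise: its value at h is the
    weak integral of phi t h. Testing shows that this is linear in h, and bounded
    because phi is dominated. By iteration all spaces of multilinear forms have weak
    integrals. *)
Lemma test_family_clinear (E F : normedModType R) (Lam : set (clinear F R * R)) :
  test_family Lam -> test_family (lift_tests E Lam).
Proof.
move=> tL; have wL := tf_weight tL; split.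
- move=> L c c0 H; apply: clinear_norm_le => // h.
  apply: (tf_norming tL) => [|l Ll]; first by rewrite mulr_ge0.
  by rewrite mulrAC -mulrA; exact: (H _ (lift_testsP h Ll)).
- move=> _ [[l h] /= Ll <-] /=; have [l20 lw] := wL _ Ll.
  split=> [|L]; first by rewrite mulr_ge0.
  by rewrite (le_trans (lw _))// -mulrA ler_wpM2l// mulrC clinear_normP.
move=> phi c c0 mphi phiK.
have mphih l h : Lam l -> measurable_fun D (fun t => l.1 (phi t h)).
  by move=> Ll; exact: mphi _ (lift_testsP h Ll).
have bphi h t : D t -> b t -> `|phi t h| <= c * `|h| * K t.
  move=> Dt bt; rewrite (le_trans (clinear_normP _ _))// mulrAC ler_wpM2r//.
  exact: phiK.
have ch h : 0 <= c * `|h : E| by rewrite mulr_ge0.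
have lphi l h t : Lam l -> D t -> b t -> `|l.1 (phi t h)| <= l.2 * (c * `|h|) * K t.
  move=> Ll Dt bt; have [l20 lw] := wL _ Ll.
  by rewrite (le_trans (lw _))// -mulrA ler_wpM2l// bphi.
have iphi l h (Ll : Lam l) : mu.-integrable D (EFin \o (fun t => l.1 (phi t h))) /\
    `|\int[mu]_(t in D) l.1 (phi t h)|%R <= l.2 * (c * `|h|) * M.
  apply: dom; first by rewrite mulr_ge0// (wL _ Ll).1.
    exact: mphih.
  by move=> t Dt bt; exact: lphi.
have /choice[y yP] h : exists y, forall l, Lam l ->
    l.1 y = (\int[mu]_(t in D) l.1 (phi t h))%R.
  by apply: (tf_representing tL (ch h)) => [l Ll|t Dt bt]; [exact: mphih|exact: bphi].
have yl : linear y.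
  move=> a h k; apply: (test_family_eq tL) => l Ll.
  rewrite clinear_add clinear_scale !yP//.
  have [ih _] := iphi _ h Ll; have [ik _] := iphi _ k Ll.
  rewrite [RHS](_ : _ = \int[mu]_(t in D) (a * l.1 (phi t h) + l.1 (phi t k)))%R.
    by apply: eq_Rintegral => t _; rewrite clinear_add clinear_scale clinear_add clinear_scale.
  rewrite RintegralD// ?RintegralZl//.
  rewrite (_ : _ \o _ = (fun t => a%:E * (l.1 (phi t h))%:E)%E)//.
  exact: integrableZl.
have yb h : `|y h| <= c * M * `|h|.
  apply: (tf_norming tL) => [|l Ll]; first by rewrite !mulr_ge0.
  rewrite yP// (le_trans (iphi _ h Ll).2)//.
  by rewrite (_ : _ * M = c * M * `|h| * l.2)//; ring.
by exists (mk_clinear yl yb) => _ [[l h] /= Ll <-] /=; exact: yP.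
Qed.

End weak_integral.

Arguments lift_tests {R} E {F} Lam.

(** * Differentiation under the integral *)

Section differentiation_under_integral.
Context {R : realType} {d : measure_display} {T : measurableType d}.
Variables (mu : {measure set T -> \bar R}) (D : set T) (b : T -> bool) (K : T -> R) (M : R).
Hypothesis mD : measurable D.
Hypothesis K0 : forall t, 0 <= K t.
Hypothesis M0 : 0 <= M.
Hypothesis dom : dominated mu D b K M.
Context {E : normedModType R}.
Variables (U : set E) (al : R).
Hypotheses (oU : open U) (al01 : 0 < al <= 1).

(** The derivative in the direction h is the limit of the difference quotients with
    steps s_n = c / (n + 1), c so small that all points x + s_n h lie in U. *)
Lemma measurable_fun_fderiv (F : normedModType R) (l : clinear F R) (g : E -> T -> F)
    (g' : T -> clinear E F) x h : U x ->
  (forall y, U y -> measurable_fun D (fun t => l (g y t))) ->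
  (forall t, D t -> is_fderiv U (g ^~ t) x (g' t)) ->
  measurable_fun D (fun t => l (g' t h)).
Proof.
move=> Ux mg dg; have [r r0 Ur] := open_norm_ball oU Ux.
have h1 : 0 < `|h| + 1 by rewrite ltr_wpDl.
pose s (n : nat) : R := r / (`|h| + 1) * n.+1%:R^-1.
have s0 n : 0 < s n by rewrite !mulr_gt0// invr_gt0.
have sh n : `|s n *: h| < r.
  rewrite normrZ gtr0_norm// /s.
  rewrite [ltLHS](_ : _ = r * (`|h| / (`|h| + 1)) * n.+1%:R^-1); last by ring.
  rewrite (@le_lt_trans _ _ (r * (`|h| / (`|h| + 1))))//.
    by rewrite ler_piMr ?mulr_ge0 ?divr_ge0 ?(ltW h1) ?(ltW r0)// invf_le1// ler1n.
  by rewrite gtr_pMr// ltr_pdivrMr// mul1r ltrDl.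
have Us n : U (s n *: h + x) by apply: Ur; rewrite addrK.
have s_cvg : s @ \oo --> (0 : R).
  by rewrite -(mulr0 (r / (`|h| + 1))); apply: cvgMl_tmp; exact: cvg_harmonic.
apply: (@measurable_fun_cvg _ _ _ _ (fun n t => (s n)^-1 * (l (g (s n *: h + x) t) - l (g x t)))).
  move=> n; apply: measurable_funM => //; apply: measurable_funB; exact: mg.
move=> t Dt; apply/cvgrPdist_le => e e0.
have l1 : 0 < `|l| + 1 by rewrite ltr_wpDl.
have e1 : 0 < e / (`|l| + 1) / (`|h| + 1) by rewrite !divr_gt0.
have /is_fderivP /(_ _ e1)[dl dl0 Hd] := dg _ Dt.
have dh : 0 < dl / (`|h| + 1) by rewrite divr_gt0.
have s_small : \forall n \near \oo, `|s n| < dl / (`|h| + 1).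
  by apply: (@cvgr0_norm_lt _ _ nat \oo _ s).
near=> n.
have sn : `|s n| < dl / (`|h| + 1) by near: n.
have shd : `|s n *: h| < dl.
  rewrite normrZ (@le_lt_trans _ _ (`|s n| * (`|h| + 1)))//.
    by rewrite ler_wpM2l// lerDl.
  by rewrite -ltr_pdivlMr.
have := Hd _ (Us n); rewrite addrK => /(_ shd) H.
rewrite -(ler_pM2l (s0 n)) -[X in X * `|_|]gtr0_norm// -normrM mulrBr mulrA.
rewrite mulfV ?gt_eqF// mul1r distrC -[_ * l _]clinear_scale -clinear_scale -!clinear_sub.
rewrite (le_trans (clinear_normP _ _))//.
rewrite (le_trans (ler_wpM2l (normr_ge0 l) H))// normrZ gtr0_norm//.
rewrite [leLHS](_ : _ = s n * (e * (`|l| / (`|l| + 1)) * (`|h| / (`|h| + 1)))); last by ring.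
rewrite ler_pM2l// -mulrA ler_piMr ?(ltW e0)// mulr_ile1 ?divr_ge0// ?(ltW l1) ?(ltW h1)//.
  by rewrite ler_pdivrMr// mul1r lerDl.
by rewrite ler_pdivrMr// mul1r lerDl.
Unshelve. all: by end_near. Qed.

Lemma dominated_integralB (u v : T -> R) c :
  mu.-integrable D (EFin \o u) -> mu.-integrable D (EFin \o v) ->
  0 <= c -> (forall t, D t -> b t -> `|u t - v t| <= c * K t) ->
  `|(\int[mu]_(t in D) u t - \int[mu]_(t in D) v t)%R| <= c * M.
Proof.
move=> iu iv c0 H; rewrite -RintegralB//.
apply: (dom c0 _ H).2; apply: measurable_funB.
  by move/integrableP : iu => [/measurable_EFinP].
by move/integrableP : iv => [/measurable_EFinP].
Qed.

Definition weak_integral (F : normedModType R) (Lam : set (clinear F R * R))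
    (phi : T -> F) (y : F) := forall l, Lam l ->
  mu.-integrable D (EFin \o (fun t => l.1 (phi t))) /\
  l.1 y = (\int[mu]_(t in D) l.1 (phi t))%R.

(** Inequalities between values of G pass to I by testing. The derivative of I is the
    weak integral of the derivatives of G: by [mean_value_le] the remainder of order 1
    is at most c (K t) |y - x| `^ (1 + al) for all t, and this passes to the integral.
    Induction on m then treats the derivative, with values in a space of linear maps.
    *)
Lemma Cs_le_integral m (F : normedModType R) (Lam : set (clinear F R * R))
    (G : E -> T -> F) (I : E -> F) c :
  test_family mu D b K Lam -> 0 <= c ->
  (forall t, D t -> Cs_le (b t) m al U (G^~ t) (c * K t)) ->
  (forall x, U x -> weak_integral Lam (G x) (I x)) ->
  Cs_le true m al U I (c * M).
Proof.
have diff (F' : normedModType R) (Lam' : set (clinear F' R * R)) (p q : T -> F') (x y : F') c' :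
    test_family mu D b K Lam' -> 0 <= c' ->
    weak_integral Lam' p x -> weak_integral Lam' q y ->
    (forall t, D t -> b t -> `|p t - q t| <= c' * K t) -> `|x - y| <= c' * M.
  move=> tL c'0 px qy H; apply: (tf_norming tL) => [|l Ll]; first by rewrite mulr_ge0.
  have [ip xE] := px _ Ll; have [iq yE] := qy _ Ll.
  have [l20 lw] := tf_weight tL Ll.
  rewrite clinear_sub xE yE mulrC mulrA; apply: dominated_integralB => //.
    by rewrite mulr_ge0.
  by move=> t Dt bt; rewrite -clinear_sub (le_trans (lw _))// -mulrA ler_wpM2l// H.
elim: m F Lam G I c => [|m IH] F Lam G I c tL c0 /= HG GI.
  move=> _ x y Ux Uy; rewrite mulrAC.
  apply: (diff _ _ _ _ _ _ _ tL _ (GI _ Ux) (GI _ Uy)).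
    by rewrite mulr_ge0 ?powR_ge0.
  by move=> t Dt bt; rewrite mulrAC; exact: HG.
split.
  move=> _ x y Ux Uy; rewrite mulrAC.
  apply: (diff _ _ _ _ _ _ _ tL _ (GI _ Ux) (GI _ Uy)).
    by rewrite mulr_ge0.
  by move=> t Dt bt; rewrite mulrAC; exact: (HG _ Dt).1.
have /choice[G' G'P] t : exists g' : E -> clinear E F, D t ->
    (forall x, U x -> is_fderiv U (G^~ t) x (g' x)) /\ Cs_le (b t) m al U g' (c * K t).
  have [Dt|Dt] := pselect (D t); last by exists (fun=> 0).
  by have [_ [g' dg Hg]] := HG _ Dt; exists g'.
have cK t : 0 <= c * K t by rewrite mulr_ge0.
have G'b x t : U x -> D t -> b t -> `|G' t x| <= c * K t.
  move=> Ux Dt bt; have [dG _] := G'P _ Dt; have [LG _] := HG _ Dt.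
  exact: (fderiv_sup_norm_le oU (cK t) dG LG bt Ux).
have mG y l : U y -> Lam l -> measurable_fun D (fun t => l.1 (G y t)).
  by move=> Uy Ll; have [/integrableP[/measurable_EFinP]] := GI _ Uy _ Ll.
have tL' : test_family mu D b K (lift_tests E Lam).
  exact: (@test_family_clinear _ _ _ mu D b K M).
have mG' x l : U x -> lift_tests E Lam l -> measurable_fun D (fun t => l.1 (G' t x)).
  move=> Ux [[l0 h] /= Ll <-] /=.
  apply: (measurable_fun_fderiv h Ux (fun y Uy => mG _ _ Uy Ll)) => t Dt.
  by have [dG _] := G'P _ Dt; exact: dG.
have /choice[I' I'P] x : exists L : clinear E F, U x ->
    weak_integral (lift_tests E Lam) (G'^~ x) L.
  have [Ux|Ux] := pselect (U x); last by exists 0.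
  have [L LP] := tf_representing tL' c0 (fun l Ll => mG' _ _ Ux Ll)
    (fun t Dt bt => G'b _ _ Ux Dt bt).
  exists L => _ l Ll; split; last exact: LP.
  have [l20 lw] := tf_weight tL' Ll.
  apply: (dom (mulr_ge0 l20 c0) (mG' _ _ Ux Ll) _).1 => t Dt bt.
  by rewrite (le_trans (lw _))// -mulrA ler_wpM2l// G'b.
exists I'; last first.
  by apply: (IH _ _ _ _ _ tL' c0 _ I'P) => t Dt; have [] := G'P _ Dt.
case/andP: al01 => al0 al1.
have G'mod x y t : U x -> U y -> `|x - y| <= 1 -> D t -> b t ->
    `|G' t x - G' t y| <= c * K t * `|x - y| `^ al.
  move=> Ux Uy xy1 Dt bt; have [_] := G'P _ Dt.
  case: (m) => [|n] /=; first exact.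
  move=> [LG _]; rewrite (le_trans (LG bt _ _ Ux Uy))// ler_wpM2l//.
  have [->|xy0] := eqVneq (x - y) 0; first by rewrite normr0 powR_ge0.
  by rewrite ger1_powR// normr_gt0 xy0.
move=> x Ux; apply/is_fderivP => e e0.
have [r r0 Ur] := open_norm_ball oU Ux.
have cM1 : 0 < c * M + 1 by rewrite ltr_wpDl// mulr_ge0.
(* The radius at which c M |h| `^ al falls below e. *)
pose dl := (e / (c * M + 1)) `^ (al^-1).
have dl0 : 0 < dl by rewrite powR_gt0// divr_gt0.
exists (Num.min 1 (Num.min r dl)); first by rewrite !lt_min ltr01 r0.
move=> y Uy; rewrite !lt_min => /and3P[y1 yr ydl].
have seg (s : R) : 0 <= s <= 1 -> `|s *: (y - x)| <= `|y - x|.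
  by case/andP => s0 s1; rewrite normrZ ger0_norm// ler_piMl.
set h := y - x.
have wL : weak_integral Lam (fun t => G' t x h) (I' x h).
  move=> l Ll; have [] := I'P _ Ux _ (lift_testsP h Ll).
  by [].
(* Both sides of the Taylor remainder are weak integrals, so it may be estimated for
   fixed t. *)
have wD : weak_integral Lam (fun t => G y t - G x t) (I y - I x).
  move=> l Ll; have [iy Ey] := GI _ Uy _ Ll; have [ix Ex] := GI _ Ux _ Ll.
  have E1 : (fun t => l.1 (G y t - G x t)) = (fun t => l.1 (G y t) - l.1 (G x t)).
    by apply/funext => t; rewrite clinear_sub.
  split; last by rewrite clinear_sub Ey Ex -RintegralB// -E1.
  rewrite E1 (_ : _ \o _ = (fun t => (l.1 (G y t))%:E - (l.1 (G x t))%:E)%E)//.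
  exact: integrableB.
apply: (@le_trans _ _ ((c * `|h| `^ al * `|h|) * M)).
  apply: (diff _ _ _ _ _ _ _ tL _ wD wL); first by rewrite !mulr_ge0 ?powR_ge0.
  move=> t Dt bt; have [dG _] := G'P _ Dt.
  rewrite (_ : _ - _ = (G y t - G' t x y) - (G x t - G' t x x)); last first.
    by rewrite /h clinear_sub !opprB addrACA [RHS]addrACA [- G x t - _]addrC.
  rewrite (_ : _ * K t = (c * K t * `|h| `^ al) * `|h|); last by ring.
  apply: (@mean_value_le _ _ _ U (fun z => G z t - G' t x z)
    (fun z => G' t z - G' t x) Lam) => //.
  - exact: (tf_norming tL).
  - exact: (tf_weight tL).
  - by rewrite mulr_ge0 ?powR_ge0.
  - by move=> s s01; apply: Ur; rewrite addrK (le_lt_trans (seg _ s01)).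
  - move=> z Uz; apply: is_fderivD; first exact: dG.
    exact: (is_fderiv_clinear U (- G' t x)).
  - move=> s s01; have Us : U (s *: (y - x) + x).
      by apply: Ur; rewrite addrK (le_lt_trans (seg _ s01)).
    rewrite (le_trans (G'mod _ _ _ Us Ux _ Dt bt)) ?addrK//.
      by rewrite (le_trans (seg _ s01))// ltW.
    rewrite ler_wpM2l// ge0_ler_powR ?nnegrE// ?(ltW al0)//.
    exact: seg.
rewrite mulrAC ler_wpM2r// mulrAC.
have : `|h| `^ al <= e / (c * M + 1).
  rewrite (@le_trans _ _ (dl `^ al))//.
    by rewrite ge0_ler_powR ?nnegrE ?(ltW al0) ?(ltW dl0) ?(ltW ydl).
  by rewrite /dl -powRrM mulVf ?gt_eqF// powRr1// divr_ge0 ?(ltW e0) ?(ltW cM1).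
move=> /(ler_wpM2l (mulr_ge0 c0 M0)) /le_trans; apply.
by rewrite mulrCA ler_piMr ?(ltW e0)// ler_pdivrMr// mul1r lerDl.
Qed.

End differentiation_under_integral.

(** * Norm bounds and Hoelder norms *)

Section conversion.
Context {R : realType} {E : normedModType R}.
Implicit Types (U : set E) (al : R).

Lemma nnsup_ge0 (A : set (\bar R)) : (0 <= nnsup A)%E.
Proof. by apply: ereal_sup_ubound; right. Qed.

Lemma nnsup_le (A : set (\bar R)) (y : \bar R) : (0 <= y)%E ->
  (forall x, A x -> (x <= y)%E) -> (nnsup A <= y)%E.
Proof. by move=> y0 Ay; apply: ge_ereal_sup => x [/Ay|->]. Qed.

Lemma le_nnsup (A : set (\bar R)) (x : \bar R) : A x -> (x <= nnsup A)%E.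
Proof. by move=> Ax; apply: ereal_sup_ubound; left. Qed.

Lemma holder_seminormP al U (F : normedModType R) (f : E -> F) (K : R) : 0 <= K ->
  (holder_seminorm al U f <= K%:E)%E <->
  (forall x y, U x -> U y -> `|f x - f y| <= K * `|x - y| `^ al).
Proof.
move=> K0; split=> [H x y Ux Uy|H].
  have [->|/eqP xy] := eqVneq x y; first by rewrite subrr normr0 mulr_ge0// powR_ge0.
  have : ((`|f x - f y| / `|x - y| `^ al)%:E <= K%:E)%E.
    by apply: le_trans H; apply: le_nnsup; exists (x, y).
  by rewrite lee_fin ler_pdivrMr// powR_gt0// normr_gt0 subr_eq0; exact/eqP.
apply: nnsup_le; first by rewrite lee_fin.
move=> _ [[x y] /= [Ux Uy /eqP xy] <-].
by rewrite lee_fin ler_pdivrMr ?H// powR_gt0// normr_gt0 subr_eq0.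
Qed.

Lemma lipschitz_seminormP U (F : normedModType R) (f : E -> F) (K : R) : 0 <= K ->
  (holder_seminorm 1 U f <= K%:E)%E <-> lip_le true U f K.
Proof.
move=> K0; split=> [/(holder_seminormP _ _ _ K0) H _ x y Ux Uy|H].
  by have := H _ _ Ux Uy; rewrite powRr1.
by apply/(holder_seminormP _ _ _ K0) => x y Ux Uy; rewrite powRr1// H.
Qed.

Lemma Cnorm_ge0 m al U (F : normedModType R) (f : E -> F) : (0 <= Cnorm m al U f)%E.
Proof. by rewrite le_max nnsup_ge0. Qed.

Lemma fderiv_is_fderiv U (F : normedModType R) (f : E -> F) x :
  (exists L, is_fderiv U f x L) -> is_fderiv U f x (fderiv U f x).
Proof. by move=> [L HL]; apply: getPex; exists L. Qed.

Lemma fderivE U (F : normedModType R) (f : E -> F) x L : open U -> U x ->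
  is_fderiv U f x L -> fderiv U f x = L.
Proof.
move=> oU Ux HL; apply: (is_fderiv_unique oU Ux _ HL).
by apply: fderiv_is_fderiv; exists L.
Qed.

Lemma smooth_Cs_le m al U (F : normedModType R) (f : E -> F) K :
  smooth m U f -> Cs_le false m al U f K.
Proof.
elim: m F f => [|m IH] F f //= [df Hf]; split=> //.
by exists (fderiv U f); [move=> x /df; exact: fderiv_is_fderiv|exact: IH].
Qed.

Lemma Cs_le_Cseminorm m al U (F : normedModType R) (f : E -> F) K K' : open U -> 0 <= K ->
  Cs_le false m al U f K' -> (Cseminorm m al U f <= K%:E)%E -> Cs_le true m al U f K.
Proof.
move=> oU K0; elim: m F f => [|m IH] F f /=.
  by move=> _ /(holder_seminormP _ _ _ K0) H _.
move=> [_ [f' df Hf]]; rewrite ge_max => /andP[/(lipschitz_seminormP _ _ K0) Lf Sf].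
split=> //; exists (fderiv U f).
  by move=> x Ux; apply: fderiv_is_fderiv; exists (f' x); exact: df.
by apply: IH => //; apply: Cs_le_ext Hf => x Ux; rewrite (fderivE oU Ux (df _ Ux)).
Qed.

Lemma Cs_le_smooth m al U (F : normedModType R) (f : E -> F) K : open U -> 0 < al ->
  0 <= K -> Cs_le true m al U f K ->
  smooth m U f /\ (Cseminorm m al U f <= K%:E)%E.
Proof.
move=> oU al0 K0; elim: m F f => [|m IH] F f /=.
  move=> /(_ isT) Hf; split; last exact/holder_seminormP.
  apply/subspace_continuousP => x Ux; apply/cvgrPdist_le => e e0.
  have K1 : 0 < K + 1 by rewrite ltr_wpDl.
  apply/nbhs_normP; exists ((e / (K + 1)) `^ al^-1); first by rewrite /= powR_gt0 ?divr_gt0.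
  move=> y; rewrite /ball_/= => xy Uy; rewrite (le_trans (Hf _ _ Ux Uy))//.
  have : `|x - y| `^ al <= e / (K + 1).
    have -> : e / (K + 1) = ((e / (K + 1)) `^ al^-1) `^ al.
      by rewrite -powRrM mulVf ?gt_eqF// powRr1// divr_ge0// ltW.
    by rewrite ge0_ler_powR ?nnegrE ?powR_ge0// ltW.
  move=> /(ler_wpM2l K0)/le_trans; apply.
  by rewrite mulrCA ler_piMr ?(ltW e0)// ler_pdivrMr// mul1r lerDl.
move=> [Lf [f' df Hf]].
have [|sf Sf] := IH _ (fderiv U f).
  by apply: Cs_le_ext Hf => x Ux; rewrite (fderivE oU Ux (df _ Ux)).
split; first by split=> // x Ux; exists (f' x); exact: df.
by rewrite ge_max Sf andbT; exact/lipschitz_seminormP.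
Qed.

Lemma Cnorm_sup_norm_le m al U (F : normedModType R) (f : E -> F) K :
  (Cnorm m al U f <= K%:E)%E -> sup_norm_le true U f K.
Proof.
rewrite ge_max => /andP[H _] _ x Ux; rewrite -lee_fin.
by apply: le_trans H; apply: le_nnsup; exists x.
Qed.

Lemma Cs_le_Cnorm m al U (F : normedModType R) (f : E -> F) K : open U -> 0 < al ->
  0 <= K -> sup_norm_le true U f K -> Cs_le true m al U f K ->
  smooth m U f /\ (Cnorm m al U f <= K%:E)%E.
Proof.
move=> oU al0 K0 fK Hf; have [sf Sf] := Cs_le_smooth oU al0 K0 Hf; split=> //.
rewrite ge_max Sf andbT; apply: nnsup_le; first by rewrite lee_fin.
by move=> _ [x Ux <-]; rewrite lee_fin; exact: fK.
Qed.

End conversion.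

(** * Integrable majorants *)

Section dominations.
Context {R : realType}.

(** As a supremum over the simple functions below, the integral of a nonnegative
    function is monotone whether or not the functions are measurable. *)
Lemma integral_le_lower d (T : measurableType d) (mu : {measure set T -> \bar R})
    (f g : T -> \bar R) : (forall x, 0 <= f x)%E -> (forall x, f x <= g x)%E ->
  (\int[mu]_x f x <= \int[mu]_x g x)%E.
Proof.
move=> f0 fg; rewrite !ge0_integralTE//; last by move=> x; exact: le_trans (fg x).
apply: ereal_sup_le => _ [h /= hf <-]; exists h => //= x.
exact: le_trans (fg x).
Qed.

(** For c > 0 the measurable function |u| / c lies below N. For c = 0 the function u
    may still be nonzero where N is infinite; there the bound is the limit of those
    for small c. *)
Lemma dominated_lower d (T : measurableType d) (mu : {measure set T -> \bar R})
    (D : set T) (N : T -> \bar R) : measurable D -> (forall x, 0 <= N x)%E ->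
  (\int[mu]_x N x < +oo)%E ->
  dominated mu D (fun x => (N x < +oo)%E) (fun x => fine (N x)) (fine (\int[mu]_x N x)%E).
Proof.
move=> mD N0 Noo.
have IN0 : (0 <= \int[mu]_x N x)%E by exact: integral_ge0.
have INE : (\int[mu]_x N x)%E = (fine (\int[mu]_x N x))%:E by rewrite fineK// ge0_fin_numE.
have pos (u : T -> R) (c : R) : 0 < c -> measurable_fun D u ->
    (forall t, D t -> (N t < +oo)%E -> `|u t| <= c * fine (N t)) ->
    mu.-integrable D (EFin \o u) /\
    `|\int[mu]_(t in D) u t|%R <= c * fine (\int[mu]_x N x)%E.
  move=> c0 mu_ H.
  have mE : measurable_fun D (EFin \o u) by exact/measurable_EFinP.
  have bnd : (\int[mu]_(t in D) `|(EFin \o u) t| <= (c * fine (\int[mu]_x N x))%:E)%E.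
    rewrite EFinM -INE.
    rewrite [leLHS](_ : _ = \int[mu]_(t in D) (c%:E * (c^-1 * `|u t|)%:E))%E; last first.
      by apply: eq_integral => t _ /=; rewrite -EFinM mulrA divff ?mul1r// gt_eqF.
    rewrite ge0_integralZl//=.
    - rewrite lee_pmul2l// integral_mkcond; apply: integral_le_lower => t.
        by apply: erestrict_ge0 => x _; rewrite lee_fin mulr_ge0// invr_ge0 ltW.
      rewrite patchE; case: ifPn => [/set_mem Dt|_//].
      have [Nt|Nt] := boolP (N t < +oo)%E; last first.
        by rewrite -leNgt in Nt; apply: le_trans Nt; rewrite leey.
      rewrite -(@fineK _ (N t)) ?ge0_fin_numE// lee_fin ler_pdivrMl//.
      exact: H.
    - apply/measurable_EFinP; apply: measurable_funM => //.
      exact: measurableT_comp.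
    - by move=> t _; rewrite lee_fin mulr_ge0// invr_ge0 ltW.
    - by rewrite lee_fin ltW.
  have iu : mu.-integrable D (EFin \o u).
    by apply/integrableP; split=> //; apply: le_lt_trans bnd _; rewrite ltry.
  split=> //; rewrite -lee_fin; apply: le_trans bnd.
  rewrite /Rintegral; apply: le_trans (le_abse_integral mu mD mE).
  by rewrite -abse_EFin fineK//; exact: integrable_fin_num.
move=> u c; rewrite le_eqVlt => /predU1P[<-|c0] mu_ H; last exact: pos.
have H' e : 0 < e -> forall t, D t -> (N t < +oo)%E -> `|u t| <= e * fine (N t).
  move=> e0 t Dt Nt; rewrite (le_trans (H _ Dt Nt))// mul0r mulr_ge0 ?(ltW e0)//.
  exact: fine_ge0.
split; first exact: (pos _ _ ltr01 mu_ (H' _ ltr01)).1.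
rewrite mul0r; apply/ler_addgt0Pl => e e0; rewrite addr0.
have I1 : 0 < fine (\int[mu]_x N x)%E + 1 by rewrite ltr_wpDl// fine_ge0.
have e1 : 0 < e / (fine (\int[mu]_x N x)%E + 1) by rewrite divr_gt0.
rewrite (le_trans (pos _ _ e1 mu_ (H' _ e1)).2)//.
by rewrite mulrAC ler_pdivrMr// ler_wpM2l ?(ltW e0)// lerDl.
Qed.

Lemma dominated_unit_mass d (T : measurableType d) (mu : {measure set T -> \bar R})
    (D : set T) : measurable D -> mu D = 1%E ->
  dominated mu D (fun=> true) (fun=> 1) 1.
Proof.
move=> mD D1 u c c0 mu_ H.
have iu : mu.-integrable D (EFin \o u).
  apply: measurable_bounded_integrable => //; first by rewrite D1 ltry.
  exists c; split; first exact: num_real.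
  by move=> x cx t Dt /=; rewrite (le_trans (H _ Dt isT))// mulr1 ltW.
split=> //; rewrite (le_trans (le_normr_Rintegral mD iu))//.
have -> : c * 1 = (\int[mu]_(x in D) c)%R by rewrite Rintegral_cst// D1.
apply: le_Rintegral => //.
- exact: (integrable_norm iu).
- apply: measurable_bounded_integrable => //; first by rewrite D1 ltry.
  exists c; split; first exact: num_real.
  by move=> x cx t Dt /=; rewrite ger0_norm// ltW.
- by move=> t Dt; rewrite -[leRHS]mulr1; exact: H.
Qed.

End dominations.

(** * Speed of a smooth path *)

Section path.
Context {R : realType} {E : normedModType R}.

Lemma is_fderiv_itv_unique (g : R -> E) (t : R) (L M : clinear R E) : 0 <= t <= 1 ->
  @is_fderiv R R `[0, 1] E g t L -> @is_fderiv R R `[0, 1] E g t M -> L 1 = M 1.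
Proof.
move=> /andP[t0 t1]; apply: is_fderiv_unique_dir => d d0.
(* A step at most 1/2 keeps t + s or t - s in [0, 1]. *)
pose s : R := Num.min (d / 2) 2^-1.
have s0 : 0 < s by rewrite lt_min divr_gt0//= invr_gt0.
have sd : s < d.
  by rewrite (@le_lt_trans _ _ (d / 2))// ?ge_min ?lexx// ltr_pdivrMr// ltr_pMr// ltr1n.
have s2 : s <= 2^-1 by rewrite ge_min lexx orbT.
have [th|th] := leP t 2^-1.
  exists s; first by rewrite gt_eqF.
  rewrite /= in_itv/= /GRing.scale/= mulr1 gtr0_norm//; split=> //; apply/andP; split.
    by rewrite addr_ge0// ltW.
  by rewrite (le_trans (lerD th s2))// [leRHS](splitr 1) mul1r.
exists (- s); first by rewrite oppr_eq0 gt_eqF.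
rewrite /= in_itv/= /GRing.scale/= mulr1 normrN gtr0_norm//; split=> //; apply/andP; split.
  by rewrite subr_ge0 (le_trans s2)// ltW.
by rewrite (le_trans _ t1)// gerDl oppr_le0 ltW.
Qed.

Variables (U : set E) (k : nat) (h : E -> R -> E).
Hypothesis hs : @smooth R (E * R)%type k.+2 (U `*` `[0, 1]) E (fun z => h z.1 z.2).
Hypothesis hU : forall x (t : R), U x -> 0 <= t <= 1 -> U (h x t).

Let W : set (E * R)%type := U `*` `[0, 1].
Let dh := @fderiv R (E * R)%type W E (fun z => h z.1 z.2).
Let dot x t := @fderiv R R `[0, 1] E (h x) t 1.

Let UI (x : E) (t : R) : U x -> 0 <= t <= 1 -> W (x, t).
Proof. by move=> Ux t01; split=> //=; rewrite in_itv. Qed.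

Let inlE (x : E) (t : R) : inl_clinear x + (0, t) = (x, t).
Proof. by congr (_, _); rewrite /= ?addr0 ?add0r. Qed.

Let inrE (x : E) (t : R) : inr_clinear t + (x, 0) = (x, t).
Proof. by congr (_, _); rewrite /= ?addr0 ?add0r. Qed.

Let dhP x t : U x -> 0 <= t <= 1 ->
  is_fderiv W (fun z => h z.1 z.2) (x, t) (dh (x, t)).
Proof. by move=> Ux t01; apply: fderiv_is_fderiv; apply: hs.1; exact: UI. Qed.

Lemma path_is_fderiv x t : U x -> 0 <= t <= 1 ->
  @is_fderiv R R `[0, 1] E (h x) t (clinear_comp (dh (x, t)) inr_clinear).
Proof.
move=> Ux t01.
have -> : h x = (fun z : E * R => h z.1 z.2) \o (fun s => inr_clinear s + (x, 0)).
  by apply/funext => s /=; rewrite add0r addr0.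
apply: (is_fderiv_comp (V := W)).
- by move=> s /=; rewrite in_itv/= => s01; rewrite inrE; exact: UI.
- by rewrite /= in_itv.
- by rewrite inrE; exact: dhP.
- exact: is_fderiv_affine.
Qed.

(** The time derivative of the path is a directional derivative of the joint map, so
    its regularity in space is that of the joint derivative. *)
Lemma path_dotE x t : U x -> 0 <= t <= 1 -> dot x t = dh (x, t) (0, 1).
Proof.
move=> Ux t01.
rewrite -[RHS]/(clinear_comp (dh (x, t)) inr_clinear 1).
apply: (is_fderiv_itv_unique t01 _ (path_is_fderiv Ux t01)).
by apply: fderiv_is_fderiv; eexists; exact: path_is_fderiv.
Qed.

Lemma path_Cs_le (al t : R) : 0 <= t <= 1 -> Cs_le false k.+2 al U (h ^~ t) 0.
Proof.
move=> t01; have hs' := smooth_Cs_le al 0 hs.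
have IV x : U x -> W (inl_clinear x + (0, t)) by move=> Ux; rewrite inlE; exact: UI.
have H := Cs_le_affine id_clinear IV hs'; apply: (Cs_le_ext _ H) => x Ux /=.
by rewrite add0r addr0.
Qed.

Let dh_Cs_le (al : R) : Cs_le false k.+1 al W dh 0.
Proof. by apply: (@smooth_Cs_le R (E * R)%type k.+1); exact: hs.2. Qed.

Let eval01 : clinear (clinear (E * R)%type E) E := @eval_clinear R (E * R)%type E ((0, 1) : E * R).

Lemma path_dot_Cs_le (al t : R) : 0 <= t <= 1 -> Cs_le false k.+1 al U (dot ^~ t) 0.
Proof.
move=> t01.
have IV x : U x -> W (inl_clinear x + (0, t)) by move=> Ux; rewrite inlE; exact: UI.
have H := Cs_le_affine eval01 IV (dh_Cs_le al); apply: (Cs_le_ext _ H) => x Ux.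
by rewrite inlE path_dotE.
Qed.

Lemma path_dot_is_fderiv x t : U x -> 0 <= t <= 1 ->
  exists L, @is_fderiv R R `[0, 1] E (dot x) t L.
Proof.
move=> Ux t01.
have IV s : `[0, 1]%classic s -> W (inr_clinear s + (x, 0)).
  by rewrite /= in_itv/= => s01; rewrite inrE; exact: UI.
have [_ [L HL _]] := Cs_le_affine eval01 IV (dh_Cs_le 1).
have It : `[0, 1]%classic t by rewrite /= in_itv.
exists (L t); apply: is_fderiv_ext (HL _ It) => // s.
by rewrite /= in_itv/= => s01; rewrite inrE path_dotE.
Qed.

Section along.
Variables (f : E -> R) (f' : E -> clinear E R).
Hypothesis df : forall x, U x -> is_fderiv U f x (f' x).
Hypothesis ddf : forall x, U x -> exists L, is_fderiv U f' x L.

Let speed x t := f' (h x t) (dot x t).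

Let hUI x : U x -> forall t, `[0, 1]%classic t -> U (h x t).
Proof. by move=> Ux t; rewrite /= in_itv/= => t01; exact: hU. Qed.

Lemma path_speed_continuous x : U x -> {within `[0, 1], continuous (speed x)}.
Proof.
move=> Ux; apply: is_fderiv_continuous => t It.
have t01 : 0 <= t <= 1 by move: It; rewrite /= in_itv.
have [L HL] := path_dot_is_fderiv Ux t01.
have [M HM] := ddf (hU Ux t01).
have H := is_fderiv_comp (hUI Ux) It HM (path_is_fderiv Ux t01).
eexists; exact: (is_fderiv_bilin (eval_cbilin E R) It H HL).
Qed.

(** The fundamental theorem of calculus; the speed is continuous in time because both
    the joint derivative of the path and f' are differentiable. *)
Lemma path_ftc x : U x ->
  f (h x 1) - f (h x 0) = (\int[lebesgue_measure]_(t in `[0, 1]) speed x t)%R.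
Proof.
move=> Ux; pose F t := f (h x t).
pose dF t := clinear_comp (f' (h x t)) (clinear_comp (dh (x, t)) inr_clinear).
have FP t : 0 <= t <= 1 -> @is_fderiv R R `[0, 1] R F t (dF t).
  move=> t01; apply: (is_fderiv_comp (hUI Ux)).
  - by rewrite /= in_itv.
  - exact: df (hU Ux t01).
  - exact: path_is_fderiv.
have FD (t : R) : 0 < t < 1 -> is_derive t 1 F (speed x t).
  move=> t01; have t01' : 0 <= t <= 1 by case/andP: t01 => /ltW-> /ltW->.
  have := is_fderiv_is_derive t01 (FP _ t01').
  by rewrite /= /speed path_dotE.
have Fc : {within `[0, 1], continuous F}.
  apply: is_fderiv_continuous => t; rewrite /= in_itv/= => t01.
  by exists (dF t); exact: FP.
have := @continuous_FTC2 R (speed x) F 0 1 ltr01 (path_speed_continuous Ux).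
rewrite /Rintegral => ->//.
  have [_ c0 c1] := (continuous_within_itvP F ltr01).1 Fc; split=> //.
  by move=> t; rewrite in_itv/= => /FD[].
by move=> t; rewrite in_itv/= => /FD H; rewrite derive1E; apply: derive_val.
Qed.

End along.
End path.

(** * Increments along a path *)

Section path_bounds.
Context {R : realType} {E : normedModType R}.
Variables (U : set E) (al : R) (k : nat) (h : E -> R -> E).
Hypotheses (oU : open U) (al01 : 0 < al <= 1).
Hypothesis hs : @smooth R (E * R)%type k.+2 (U `*` `[0, 1]) E (fun z => h z.1 z.2).
Hypothesis hU : forall x (t : R), U x -> 0 <= t <= 1 -> U (h x t).

Let dot x t := @fderiv R R `[0, 1] E (h x) t 1.

Lemma inner_le_dropn b m n (g : E -> E) K : 0 <= K ->
  inner_le U al b (n + m) g K -> inner_le U al b m g (2 ^+ n * K).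
Proof.
elim: n K => [|n IH] K K0; first by rewrite mul1r.
rewrite addSn exprSr -mulrA => H; apply: IH; first by rewrite mulr_ge0.
exact: inner_le_drop.
Qed.

(** The power of 2 pays for lowering the path and its time derivative from level n to
    a level m <= n: each costs at most 2 ^+ n, and the former is raised to a power at
    most n + 1. *)
Definition step_cst (n m : nat) : R := prod_cst m * comp_cst m * (2 ^+ n) ^+ n.+2.

Lemma step_cst_ge1 n m : 1 <= step_cst n m.
Proof.
have two j : 1 <= 2 ^+ j :> R by rewrite exprn_ege1// ler1n.
apply: mulr_ege1; last by rewrite exprn_ege1.
apply: mulr_ege1; last exact: comp_cst_ge1.
by apply: mulr_ege1; rewrite ?ler1n// exprn_ege1// ler1n.
Qed.

Lemma Cs_le0 b m (F : normedModType R) (V : set E) K : 0 <= K ->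
  Cs_le b m al V (fun=> 0 : F) K.
Proof.
move=> K0; elim: m F => [|m IH] F /=.
  by move=> _ x y _ _; rewrite subrr normr0 mulr_ge0// powR_ge0.
split; first by move=> _ x y _ _; rewrite subrr normr0 mulr_ge0.
exists (fun=> 0) => //; move=> x _; apply/is_fderivP => e e0; exists 1 => // y _ _.
by rewrite !subr0 normr0 mulr_ge0// ltW.
Qed.

(** For the paths along which the majorant is infinite. *)
Lemma path_end_Cs_le m (f : E -> R) : (m <= k.+2)%N -> Cs_le false m al U f 0 ->
  Cs_le false m al U (fun x => f (h x 1) - f x) 0.
Proof.
move=> mk Hf; have I1 : 0 <= (1 : R) <= 1 by rewrite ler01 lexx.
have Hh := path_Cs_le hs al I1.
have Hfh : Cs_le false m al U (f \o h^~ 1) (comp_cst m * 0 * 1 `^ (m%:R + al)).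
  apply: (Cs_le_comp oU oU al01) => //; first by move=> x Ux; exact: hU.
  split=> //; case: m mk {Hf} => // m mk.
  apply: (@Cs_leF _ _ false _ _ _ _ _ (2 ^+ (k.+2 - m.+1) * 0)).
  by apply: (Cs_le_dropn oU al01); [exact: lexx|by []|rewrite subnK].
have lN : linear (fun x : R => - x).
  by move=> a x y; rewrite opprD /GRing.scale/= mulrN.
have bN (x : R) : `|- x| <= 1 * `|x| by rewrite normrN mul1r.
have UU x : U x -> U (id_clinear x + 0) by rewrite addr0.
have HN : Cs_le false m al U (fun x => - f x) 0.
  by apply: (Cs_le_ext _ (Cs_le_affine (mk_clinear lN bN) UU Hf)) => x _ /=; rewrite addr0.
exact: (Cs_leF _ (Cs_leD Hfh HN)).
Qed.

Section increment.
Variables (m : nat) (f : E -> R) (A : R).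
Hypotheses (m1 : (1 <= m)%N) (mk : (m <= k.+1)%N) (A0 : 0 <= A).
Hypothesis Cf : Cs_le true m.+1 al U f A.

Lemma increment_integral : exists2 f' : E -> clinear E R,
  (sup_norm_le true U f' A /\ Cs_le true m al U f' A) &
  forall x, U x -> {within `[0, 1], continuous (fun t => f' (h x t) (dot x t))} /\
    f (h x 1) - f (h x 0) = (\int[lebesgue_measure]_(t in `[0, 1]) f' (h x t) (dot x t))%R.
Proof.
have [Lf [f' df Cf']] := Cf; exists f'.
  by split=> //; exact: fderiv_sup_norm_le Lf.
have ddf x : U x -> exists L, is_fderiv U f' x L.
  by move=> Ux; case: m m1 Cf' => // m' _ [_ [f'' ddf _]]; exists (f'' x); exact: ddf.
move=> x Ux; split.
  exact: (path_speed_continuous hs hU ddf).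
exact: (path_ftc hs hU df ddf).
Qed.

(** For the paths with vanishing time derivative, where the product of norms in the
    moment is 0 whatever the first factor. *)
Lemma increment0 x : (forall t, 0 <= t <= 1 -> dot x t = 0) -> U x ->
  f (h x 1) - f (h x 0) = 0.
Proof.
move=> d0 Ux; have [f' _ /(_ _ Ux)[_ ->]] := increment_integral.
rewrite /Rintegral integral0_eq// => t; rewrite /= in_itv/= => /d0 ->.
by rewrite clinear_zero.
Qed.

(** For each t the speed f' (h x t) (dot x t) is a product of a composition; its
    bounds are independent of t and survive integration over [0, 1], which has measure
    1. *)
Lemma increment_le (K B : R) : 1 <= K -> 0 <= B ->
  (forall t : R, 0 <= t <= 1 -> (Cseminorm k.+1 al U (h^~ t) <= K%:E)%E) ->
  (forall t : R, 0 <= t <= 1 -> (Cnorm k.+1 al U (dot^~ t) <= B%:E)%E) ->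
  let C := step_cst k.+1 m * A * (K `^ (k.+1%:R + al) * B) in
  sup_norm_le true U (fun x => f (h x 1) - f (h x 0)) C /\
  Cs_le true m al U (fun x => f (h x 1) - f (h x 0)) C.
Proof.
move=> K1 B0 hK dB C.
have K0 : 0 <= K by rewrite (le_trans ler01).
have [f' [f'A Cf'] inc] := increment_integral.
case/andP: (al01) => al0 al1.
pose n := (k.+1 - m)%N; have nm : (n + m = k.+1)%N by rewrite subnK.
pose K' := 2 ^+ n * K; pose B' := 2 ^+ n * B.
have n2 : 1 <= 2 ^+ n :> R by rewrite exprn_ege1// ler1n.
have K'1 : 1 <= K' by rewrite mulr_ege1.
have BB' : B <= B' by rewrite ler_peMl.
pose C1 := comp_cst m * A * K' `^ (m%:R + al).
have AC1 : A <= C1.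
  rewrite /C1 mulrAC ler_peMl// mulr_ege1 ?comp_cst_ge1//.
  by rewrite -[leLHS](powRr0 K') ler_powR// addr_ge0// ltW.
have C10 : 0 <= C1 by rewrite (le_trans A0).
have CC : prod_cst m * C1 * B' <= C.
  rewrite /C1 /K' /B' powRM ?exprn_ge0//.
  have -> : C = prod_cst m * comp_cst m * A * B * (2 ^+ k.+1) ^+ k.+3 * K `^ (k.+1%:R + al).
    by rewrite /C /step_cst; ring.
  rewrite [leLHS](_ : _ = prod_cst m * comp_cst m * A * B *
    ((2 ^+ n) `^ (m%:R + al) * 2 ^+ n) * K `^ (m%:R + al)); last by ring.
  have Q0 : 0 <= prod_cst m * comp_cst m * A * B.
    by rewrite !mulr_ge0// (le_trans ler01 (comp_cst_ge1 m)).
  have nk : 2 ^+ n <= 2 ^+ k.+1 :> R by rewrite ler_weXn2l ?ler1n// leq_subr.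
  (* Levels drop by n <= k + 1, and m + al <= k + 2. *)
  have pnk : (2 ^+ n) `^ (m%:R + al) * 2 ^+ n <= (2 ^+ k.+1) ^+ k.+3.
    rewrite [leRHS]exprSr; apply: ler_pM => //; rewrite ?powR_ge0 ?exprn_ge0//.
    rewrite (@le_trans _ _ ((2 ^+ n) `^ k.+2%:R))//.
      by rewrite ler_powR// -natr1 lerD// ler_nat.
    by rewrite powR_mulrn ?exprn_ge0// lerXn2r ?nnegrE ?exprn_ge0.
  apply: ler_pM; [|exact: powR_ge0|exact: ler_wpM2l|].
    by rewrite mulr_ge0// mulr_ge0 ?powR_ge0 ?exprn_ge0.
  by rewrite ler_powR// lerD2r ler_nat.
have CV t : 0 <= t <= 1 ->
    sup_norm_le true U (fun x => f' (h x t) (dot x t)) C /\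
    Cs_le true m al U (fun x => f' (h x t) (dot x t)) C.
  move=> t01; have Ch : Cs_le true k.+1 al U (h^~ t) K.
    apply: (Cs_le_Cseminorm oU K0 _ (hK _ t01)).
    by apply: (Cs_le_drop oU al01 _ _ (path_Cs_le hs al t01)); first exact: lexx.
  have Ih : inner_le U al true m (h^~ t) K'.
    by apply: inner_le_dropn => //; rewrite nm; split=> //; case: Ch.
  have dotB := Cnorm_sup_norm_le (dB _ t01).
  have Cd : Cs_le true m al U (dot^~ t) B'.
    apply: (Cs_le_dropn oU al01) => //; rewrite nm.
    apply: (Cs_le_Cseminorm oU B0 (path_dot_Cs_le hs al t01)).
    by apply: le_trans (dB _ t01); rewrite le_max lexx orbT.
  have ht x : U x -> U (h x t) by move=> Ux; exact: hU.
  have f'h : sup_norm_le true U (f' \o h^~ t) C1.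
    by move=> bb x Ux; rewrite (le_trans (f'A bb _ (ht _ Ux))).
  have dotB' : sup_norm_le true U (dot^~ t) B'.
    by move=> bb x Ux; rewrite (le_trans (dotB bb _ Ux)).
  have Cf'h := Cs_le_comp oU oU al01 A0 K'1 ht f'A Cf' Ih.
  split; last first.
    apply: Cs_leW CC _.
    apply: (Cs_le_prod oU al01 (eval_cbilin E R)) => //.
    exact: le_trans BB'.
  move=> bb x Ux; rewrite (le_trans _ CC)//.
  rewrite (le_trans (clinear_normP _ _))// (@le_trans _ _ (C1 * B'))//.
    by rewrite ler_pM// ?f'h ?dotB'.
  rewrite ler_wpM2r ?(le_trans B0)// ler_peMl// /prod_cst mulr_ege1 ?ler1n//.
  by rewrite exprn_ege1// ler1n.
have C0 : 0 <= C.
  have P0 : 0 <= prod_cst m :> R by rewrite mulr_ge0// exprn_ge0.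
  by apply: le_trans CC; apply: mulr_ge0; [exact: mulr_ge0|exact: le_trans BB'].
have mI : measurable (`[0, 1]%classic : set R) by exact: measurable_itv.
have vI : lebesgue_measure (`[0, 1]%classic : set R) = 1%E.
  by rewrite lebesgue_measure_itv/= lte_fin ltr01 oppr0 adde0.
have dom := @dominated_unit_mass _ _ _ (@lebesgue_measure R) `[0, 1]%classic mI vI.
have I01 (t : R) : `[0, 1]%classic t -> 0 <= t <= 1 by rewrite /= in_itv.
have J x (Ux : U x) := dom (fun t => f' (h x t) (dot x t)) C C0
   (subspace_continuous_measurable_fun mI (inc x Ux).1).
split.
  move=> _ x Ux; rewrite (inc x Ux).2 -[C]mulr1; apply: (J x Ux _).2.
  by move=> t /I01 t01 _; rewrite mulr1; exact: (CV t t01).1.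
suff : Cs_le true m al U (fun x => f (h x 1) - f (h x 0)) (C * 1) by rewrite mulr1.
apply: (@Cs_le_integral _ _ _ (@lebesgue_measure R) `[0, 1]%classic (fun=> true) (fun=> 1) 1
  mI _ _ dom E U al oU al01 m R [set (id_clinear, 1 : R)] (fun x t => f' (h x t) (dot x t))) => //.
- exact: test_family_real.
- by move=> t /I01 t01; rewrite mulr1; exact: (CV t t01).2.
move=> x Ux l /= ->; split; last exact: (inc x Ux).2.
apply: (J x Ux _).1 => t /I01 t01 _.
by rewrite mulr1; exact: (CV t t01).1.
Qed.

End increment.
End path_bounds.

(** * One application of the bias operator *)

Section bias_operator.
Context {R : realType} {E : normedModType R} (Theta : set E)
  {d : measure_display} {S : measurableType d}
  (P : E -> probability S R) (est : {mfun S >-> borel E})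
  {d' : measure_display} {Omega : measurableType d'}
  (Q : probability Omega R) (H : E -> R -> Omega -> E).
Variables (k : nat) (rho : R).
Hypotheses (oT : open Theta) (rho01 : 0 < rho <= 1).
Hypothesis hH : random_homotopy Theta P est Q H.
Hypothesis sH : homotopy_smooth Theta Q H k.+2.
Hypothesis mH : (homotopy_moment Theta Q H k.+1 rho < +oo)%E.

Let N w := ((maxe (Cseminorm0 k.+1 rho Theta (fun theta t => H theta t w)) 1)
        `^ (k.+1%:R + rho) * Cnorm0 k.+1 rho Theta (Hdot H w))%E.
Let M := fine (homotopy_moment Theta Q H k.+1 rho).

Let N0 w : (0 <= N w)%E.
Proof. by rewrite mule_ge0 ?poweR_ge0 ?nnsup_ge0. Qed.

(** If a product of two norms is finite and the first is at least 1, then either both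
    are finite or the second one is 0. In the latter case the path stands still and
    the increment vanishes. *)
Lemma increment_dominated m (g : E -> R) A w :
  (1 <= m <= k.+1)%N -> 0 <= A -> sup_norm_le true Theta g A ->
  Cs_le true m.+1 rho Theta g A ->
  @smooth R (E * R)%type k.+2 (Theta `*` `[0, 1]) E (fun z : E * R => H z.1 z.2 w) ->
  let b := (N w < +oo)%E in let C := step_cst k.+1 m * A * fine (N w) in
  sup_norm_le b Theta (fun x => g (H x 1 w) - g x) C /\
  Cs_le b m rho Theta (fun x => g (H x 1 w) - g x) C.
Proof.
move=> /andP[m1 mk] A0 gA Cg sw b C; case/andP: (rho01) => rho0 rho1.
have HU x (t : R) : Theta x -> 0 <= t <= 1 -> Theta (H x t w).
  by move=> Tx t01; apply: (homotopy_in hH) => //; rewrite in_itv.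
have H0 x : Theta x -> H x 0 w = x by move=> Tx; exact: (homotopy0 hH).
have pos : 0 < k.+1%:R + rho by rewrite ltr_wpDl.
have C0 : 0 <= C.
  apply: mulr_ge0; last exact: fine_ge0.
  by apply: mulr_ge0 => //; exact: le_trans ler01 (step_cst_ge1 _ _).
rewrite /b; case: (boolP (N w < +oo)%E) => [Nw|_]; last first.
  split=> //; apply: (@Cs_leF _ _ false _ _ _ _ _ 0).
  apply: (path_end_Cs_le (h := fun x t => H x t w) oT rho01 sw HU) => //; first by rewrite ltnW.
  apply: (@Cs_leF _ _ false _ _ _ _ _ (2 * A)).
  by apply: (Cs_le_drop oT rho01 A0) => //; exact: (Cs_leF _ Cg).
have dot_in t : 0 <= t <= 1 -> t \in `[0, 1] by rewrite in_itv.
set B := Cnorm0 k.+1 rho Theta (Hdot H w).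
have B0 : (0 <= B)%E by exact: nnsup_ge0.
have leB (t : R) : 0 <= t <= 1 -> (Cnorm k.+1 rho Theta (Hdot H w ^~ t) <= B)%E.
  by move=> t01; apply: le_nnsup; exists t => //; exact: dot_in.
have gE x : Theta x -> g (H x 1 w) - g x = g (H x 1 w) - g (H x 0 w).
  by move=> Tx; rewrite H0.
have [BE|Bn0] := eqVneq B 0%E.
  have inc0 x : Theta x -> g (H x 1 w) - g x = 0.
    move=> Tx; rewrite gE//.
    apply: (increment0 (h := fun x t => H x t w) oT sw HU m1 A0 Cg _ Tx) => t t01.
    apply/eqP; rewrite -normr_le0.
    have le0 : (Cnorm k.+1 rho Theta (Hdot H w ^~ t) <= 0%:E)%E.
      by rewrite (le_trans (leB _ t01))// BE.
    exact: (Cnorm_sup_norm_le le0 isT Tx).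
  split; first by move=> _ x Tx; rewrite inc0// normr0.
  apply: (@Cs_le_ext _ _ _ _ _ _ _ (fun=> 0)); last exact: Cs_le0.
  by move=> x Tx; rewrite inc0.
have Bpos : (0 < B)%E by rewrite lt_neqAle eq_sym Bn0.
set KK := maxe (Cseminorm0 k.+1 rho Theta (fun theta t => H theta t w)) 1%E.
have KK1 : (1 <= KK)%E by rewrite le_max lexx orbT.
have NE : N w = (KK `^ (k.+1%:R + rho) * B)%E by [].
have Bfin : B \is a fin_num.
  rewrite ge0_fin_numE// ltNge leye_eq; apply/eqP => By.
  move: Nw; rewrite NE By gt0_muley ?ltxx// poweR_gt0//.
  exact: lt_le_trans KK1.
have Kfin : KK \is a fin_num.
  rewrite ge0_fin_numE ?(le_trans _ KK1)// ltNge leye_eq; apply/eqP => Ky.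
  by move: Nw; rewrite NE Ky poweRyr ?gt_eqF// gt0_mulye// ltxx.
have KE : KK = (fine KK)%:E by rewrite fineK.
have BE : B = (fine B)%:E by rewrite fineK.
have K1 : 1 <= fine KK by rewrite -lee_fin -KE.
have Bf0 : 0 <= fine B by rewrite fine_ge0.
have leK (t : R) : 0 <= t <= 1 ->
    (Cseminorm k.+1 rho Theta (fun x => H x t w) <= (fine KK)%:E)%E.
  move=> t01; rewrite -KE le_max; apply/orP; left; apply: le_nnsup.
  by exists t => //; exact: dot_in.
have leB' (t : R) : 0 <= t <= 1 ->
    (Cnorm k.+1 rho Theta (Hdot H w ^~ t) <= (fine B)%:E)%E.
  by move=> t01; rewrite -BE; exact: leB.
have := increment_le (h := fun x t => H x t w) oT rho01 sw HU m1 mk A0 Cg K1 Bf0 leK leB'.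
have -> : step_cst k.+1 m * A * (fine KK `^ (k.+1%:R + rho) * fine B) = C.
  by rewrite /C NE fineM ?fin_num_poweR// fine_poweR.
move=> [Hb HC]; split; first by move=> _ x Tx; rewrite gE//; exact: Hb.
by apply: (Cs_le_ext _ HC) => x Tx; rewrite gE.
Qed.

Lemma lipschitz_measurable (g : E -> R) A : 0 <= A -> lip_le true Theta g A ->
  measurable_fun (Theta : set (borel E)) (g : borel E -> R).
Proof.
move=> A0 Lg; apply: (measurability _ (RGenOInfty.measurableE R)) => _ [_ [a ->] <-].
apply: sub_sigma_algebra; rewrite openE => x [Tx /=]; rewrite in_itv/= andbT => ax.
have [r r0 rT] := open_norm_ball oT Tx.
have A1 : 0 < A + 1 by rewrite ltr_wpDl.
apply/nbhs_normP; exists (Num.min r ((g x - a) / (A + 1))).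
  by rewrite /= lt_min r0 divr_gt0// subr_gt0.
move=> y; rewrite /ball_/= lt_min => /andP[yr ya].
have Ty : Theta y by apply: rT; rewrite distrC.
split=> //=; rewrite in_itv/= andbT -subr_gt0.
have : `|g x - g y| < g x - a.
  rewrite (le_lt_trans (Lg isT _ _ Tx Ty))// (@le_lt_trans _ _ (`|x - y| * (A + 1)))//.
    by rewrite mulrC ler_wpM2l// lerDl.
  by rewrite -ltr_pdivlMr.
by move=> /ltr_normlW; rewrite ltrD2l ltrN2 subr_gt0.
Qed.

(** Change of variables: H x 1 has the law of the estimator. *)
Lemma TopE (g : E -> R) A x : 0 <= A -> sup_norm_le true Theta g A ->
  lip_le true Theta g A -> Theta x ->
  [/\ measurable_fun setT (fun w => g (H x 1 w)),
      Q.-integrable setT (EFin \o (fun w => g (H x 1 w))) &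
      Top Theta P est g x = (\int[Q]_w g (H x 1 w))%R].
Proof.
move=> A0 gA Lg Tx.
have I1 : (1 : R) \in `[0, 1] by rewrite in_itv/= ler01 lexx.
have HT w : Theta (H x 1 w) by exact: (homotopy_in hH).
have mg := lipschitz_measurable A0 Lg.
have mT : measurable (Theta : set (borel E)) by exact: sub_sigma_algebra.
have mX := homotopy_measurable hH Tx I1.
pose X := HB.pack_for {mfun Omega >-> borel E} (H x 1 : Omega -> borel E)
  (isMeasurableFun.Build _ _ _ _ (H x 1 : Omega -> borel E) mX).
(* Outside Theta the function g is arbitrary, hence possibly not measurable. *)
pose gT : borel E -> R := g \_ Theta.
have gTE w : gT (H x 1 w) = g (H x 1 w) by rewrite /gT patchE mem_set.
have mgT : measurable_fun setT gT by apply/(measurable_restrictT _ mT).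
have mgX : measurable_fun setT (fun w => g (H x 1 w)).
  rewrite (_ : (fun w => _) = gT \o X); last by apply/funext => w /=; rewrite gTE.
  exact: measurableT_comp.
have ig : Q.-integrable setT (EFin \o (fun w => g (H x 1 w))).
  apply: measurable_bounded_integrable => //.
    by rewrite [X in (X < _)%E]probability_setT ltry.
  exists A; split; first exact: num_real.
  by move=> c Ac w _ /=; rewrite (le_trans (gA isT _ (HT w)))// ltW.
split=> //.
rewrite /Top Rintegral_mkcond /Rintegral.
rewrite (eq_measure_integral (distribution Q X)); last first.
  by move=> B mB _; rewrite /= -(homotopy1 hH Tx mB).
congr fine; rewrite (@integral_pushforward _ _ Omega (borel E) R X mX Q setT (EFin \o gT))//.
- by rewrite preimage_setT; apply: eq_integral => w _ /=; rewrite gTE.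
- exact/measurable_EFinP.
- rewrite preimage_setT; apply: eq_integrable ig => // w _ /=.
  by rewrite gTE.
Qed.

(** One derivative is traded for one factor M. The bias B g x is the expectation of
    the increments of g along the paths issued from x, to which [Cs_le_integral]
    applies off a null set. *)
Lemma Bop_step m (g : E -> R) A : (1 <= m <= k.+1)%N -> 0 <= A ->
  sup_norm_le true Theta g A -> Cs_le true m.+1 rho Theta g A ->
  sup_norm_le true Theta (Bop Theta P est g) (step_cst k.+1 m * A * M) /\
  Cs_le true m rho Theta (Bop Theta P est g) (step_cst k.+1 m * A * M).
Proof.
move=> mk A0 gA Cg; have Lg : lip_le true Theta g A by case: Cg.
have [Z [mZ QZ sZ]] := sH.
pose D := ~` Z; have mD : measurable D by exact: measurableC.
have QD : Q D = 1%E by rewrite probability_setC// QZ sube0.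
have sD w : D w -> @smooth R (E * R)%type k.+2 (Theta `*` `[0, 1]) E
    (fun z : E * R => H z.1 z.2 w).
  by move=> Dw; apply: contrapT => nsw; apply: Dw; exact: sZ.
have dom := dominated_lower mD N0 mH.
have fN0 w : 0 <= fine (N w) by exact: fine_ge0.
have M0 : 0 <= M by apply: fine_ge0; apply: integral_ge0 => w _; exact: N0.
have c0 : 0 <= step_cst k.+1 m * A.
  by apply: mulr_ge0 => //; exact: le_trans ler01 (step_cst_ge1 _ _).
pose G x w := g (H x 1 w) - g x.
have GN w (Dw : D w) := increment_dominated mk A0 gA Cg (sD w Dw).
have mG x : Theta x -> measurable_fun D (G x).
  move=> Tx; have [mg _ _] := TopE A0 gA Lg Tx.
  by apply: measurable_funB => //; exact: measurable_funTS.
have BopE x : Theta x -> Bop Theta P est g x = (\int[Q]_(w in D) G x w)%R.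
  move=> Tx; have [mg ig TE] := TopE A0 gA Lg Tx; rewrite /Bop TE.
  have icst : Q.-integrable D (EFin \o cst (g x)).
    by apply: finite_measure_integrable_cst.
  rewrite RintegralB//; last exact: integrableS ig.
  rewrite Rintegral_cst// [X in fine X]QD mulr1; congr (_ - _).
  by rewrite /Rintegral (negligible_integral mZ measurableT ig QZ) setTD.
have J x (Tx : Theta x) := dom (G x) _ c0 (mG x Tx) (fun w Dw bw => (GN w Dw).1 bw x Tx).
split.
  by move=> _ x Tx; rewrite BopE//; exact: (J x Tx).2.
apply: (@Cs_le_integral _ _ _ Q D _ (fun w => fine (N w)) M mD fN0 M0 dom E Theta rho oT rho01
  m R [set (id_clinear, 1 : R)] G) => //.
- exact: test_family_real.
- by move=> w Dw; exact: (GN w Dw).2.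
by move=> x Tx l /= ->; split; [exact: (J x Tx).1|exact: BopE].
Qed.

End bias_operator.

(** * Iteration *)

Section iteration.
Context {R : realType}.

(** The application number j' + 1 of the operator ends at level n - j'. *)
Fixpoint iter_cst (n j : nat) : R := if j is j'.+1 then step_cst n (n - j') * iter_cst n j' else 1.

Lemma iter_cst_ge1 n j : 1 <= iter_cst n j.
Proof. by elim: j => //= j IH; apply: mulr_ege1 => //; exact: step_cst_ge1. Qed.

Lemma iter_cst_le n i j : (i <= j)%N -> iter_cst n i <= iter_cst n j.
Proof.
apply: (homo_leq _ le_trans) => // j' /=.
by rewrite ler_peMl ?step_cst_ge1// (le_trans ler01)// iter_cst_ge1.
Qed.

End iteration.

(* s = k + 1 + rho. *)
Theorem theorem3p1 (R : realType) (k : nat) (rho : R) :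
  (1 <= k)%N -> 0 < rho <= 1 ->
  exists D : R, 1 <= D /\
    forall (E : completeNormedModType R) (Theta : set E)
      (d : measure_display) (S : measurableType d)
      (P : E -> probability S R) (est : {mfun S >-> borel E})
      (d' : measure_display) (Omega : measurableType d')
      (Q : probability Omega R) (H : E -> R -> Omega -> E) (f : E -> R),
    open Theta ->
    is_estimator Theta P est ->
    Cspace k.+1 rho Theta f ->
    random_homotopy Theta P est Q H ->
    homotopy_smooth Theta Q H k.+1 ->
    (homotopy_moment Theta Q H k rho < +oo)%E ->
    forall j : nat, (1 <= j <= k)%N ->
      Cspace 1 rho Theta (iter j (Bop Theta P est) f) /\
      (Cnorm 1 rho Theta (iter j (Bop Theta P est) f) <=
         D%:E * Cnorm k.+1 rho Theta f * homotopy_moment Theta Q H k rho ^+ j)%E.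
Proof.
case: k => // k _ rho01; have rho0 : 0 < rho by case/andP: rho01.
have D1 : 1 <= 2 ^+ k.+1 * iter_cst k.+1 k.+1 :> R.
  by apply: mulr_ege1; [rewrite exprn_ege1// ler1n|exact: iter_cst_ge1].
exists (2 ^+ k.+1 * iter_cst k.+1 k.+1); split=> //.
move=> E Theta d S P est d' Omega Q H f oT _ [sf nf] hH sH mH j /andP[j1 jk].
set M := fine (homotopy_moment Theta Q H k.+1 rho).
have mom0 : (0 <= homotopy_moment Theta Q H k.+1 rho)%E.
  by apply: integral_ge0 => w _; rewrite mule_ge0 ?poweR_ge0 ?nnsup_ge0.
have ME : homotopy_moment Theta Q H k.+1 rho = M%:E by rewrite fineK// ge0_fin_numE.
have M0 : 0 <= M by exact: fine_ge0.
set A := fine (Cnorm k.+2 rho Theta f).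
have AE : Cnorm k.+2 rho Theta f = A%:E by rewrite fineK// ge0_fin_numE// Cnorm_ge0.
have A0 : 0 <= A by apply: fine_ge0; exact: Cnorm_ge0.
have fA : sup_norm_le true Theta f A by apply: (@Cnorm_sup_norm_le _ _ k.+2 rho); rewrite AE.
have Cf : Cs_le true k.+2 rho Theta f A.
  apply: (Cs_le_Cseminorm oT A0 (smooth_Cs_le rho 0 sf)).
  by rewrite -AE le_max lexx orbT.
have it i : (i <= k.+1)%N ->
    sup_norm_le true Theta (iter i (Bop Theta P est) f) (iter_cst k.+1 i * A * M ^+ i) /\
    Cs_le true (k.+1 - i).+1 rho Theta (iter i (Bop Theta P est) f)
      (iter_cst k.+1 i * A * M ^+ i).
  elim: i => [_|i IH ik]; first by rewrite /= expr0 mulr1 mul1r.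
  have [fi Ci] := IH (ltnW ik).
  have mk : (1 <= k.+1 - i <= k.+1)%N by rewrite subn_gt0 ik leq_subr.
  have A'0 : 0 <= iter_cst k.+1 i * A * M ^+ i.
    by rewrite !mulr_ge0 ?exprn_ge0// (le_trans ler01)// iter_cst_ge1.
  have CE : step_cst k.+1 (k.+1 - i) * (iter_cst k.+1 i * A * M ^+ i) * M =
      iter_cst k.+1 i.+1 * A * M ^+ i.+1 by rewrite /= exprSr; ring.
  by have := Bop_step oT rho01 hH sH mH mk A'0 fi Ci; rewrite subnSK// -/M CE.
have [fj Cj] := it _ jk.
set A' := iter_cst k.+1 j * A * M ^+ j in fj Cj.
have A'0 : 0 <= A'.
  by rewrite !mulr_ge0 ?exprn_ge0// (le_trans ler01)// iter_cst_ge1.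
have C1 : Cs_le true 1 rho Theta (iter j (Bop Theta P est) f) (2 ^+ (k.+1 - j) * A').
  by apply: (Cs_le_dropn oT rho01 A'0 fj); rewrite addn1.
have two i : 1 <= 2 ^+ i :> R by rewrite exprn_ege1// ler1n.
have A''0 : 0 <= 2 ^+ (k.+1 - j) * A' by rewrite mulr_ge0// exprn_ge0.
have f1 : sup_norm_le true Theta (iter j (Bop Theta P est) f) (2 ^+ (k.+1 - j) * A').
  by move=> bb x Tx; rewrite (le_trans (fj bb _ Tx))// ler_peMl.
have [s1 n1] := Cs_le_Cnorm oT rho0 A''0 f1 C1.
split; first by split=> //; apply: le_lt_trans n1 _; rewrite ltry.
apply: le_trans n1 _; rewrite AE ME -EFin_expe -!EFinM lee_fin /A'.
have ij : iter_cst k.+1 j <= iter_cst k.+1 k.+1 :> R by exact: iter_cst_le.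
move: ij (iter_cst_ge1 (R := R) k.+1 j).
move: (iter_cst k.+1 k.+1) (iter_cst k.+1 j) => ck cj ckj cj1.
rewrite !mulrA ler_wpM2r ?exprn_ge0// ler_wpM2r//; apply: ler_pM => //.
- exact: le_trans ler01 cj1.
- by rewrite ler_weXn2l ?ler1n// leq_subr.
Qed.
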